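(* Let $g(x)=\alpha x^{q^k}+\beta x$ with $\alpha\in\mathbb{F}_{q^n}^*$, $\beta\in\mathbb{F}_{q^n}$, $1\le k<n$, and let $f(y)=\sum_{i=0}^d a_iy^{q^i}\in\mathbb{F}_{q^n}[y]$, $0\le d<n$, $a_d\ne0$, be not a monomial. Let $0\le h\le\ell$. If $f$ is a binomial and $h=\ell$, assume moreover $a_h\ne\beta$. Define \[m_h=\begin{cases}0 & \text{if } a_h\ne\beta,\\ \ell-h & \text{if } a_h=\beta=0,\\ \ell_2-h & \text{if } a_h=\beta\ne0.\end{cases}\] If \[\max\left\{k+d-h-m_h,\ \tfrac{d-h}{2}\right\}\le\begin{cases}\frac n2 & \text{if } m_h\le\frac{d-h}2,\\ \frac n2-1 & \text{if } m_h>\frac{d-h}{2},\end{cases}\] then $L_g\cap L_f\ne\emptyset$.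
   Context: Let $q$ be a prime power, $n\ge2$. For $f(y)=\sum_{i=0}^d a_iy^{q^i}$ with $a_d\neq0$: $\ell=\min\{i: a_i\ne0\}$; when $f$ is not a monomial (i.e. has at least two nonzero coefficients), $\ell_2=\min\{i>\ell: a_i\ne0\}$ and $\ell_3=\max\{i<d:a_i\ne0\}$; $f$ is a binomial if it has exactly two nonzero coefficients. Coefficients $a_i$ with $i$ outside the support are $0$. For an integer $0\le h<n$: $L_g=\{\langle(x,g(x))\rangle_{\mathbb{F}_{q^n}}:x\in\mathbb{F}_{q^n}^*\}$ and $L_f=\{\langle(y^{q^h},f(y))\rangle_{\mathbb{F}_{q^n}}:y\in\mathbb{F}_{q^n}^*\}$, points of $\mathrm{PG}(1,q^n)$. *)

(* Defs.v *)
From HB Require Import structures.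
From mathcomp Require Import all_boot all_order all_algebra.
Set Implicit Arguments. Unset Strict Implicit. Unset Printing Implicit Defensive.
Import Order.TTheory GRing.Theory Num.Theory.
Local Open Scope ring_scope.

Definition prime_power (q : nat) : Prop :=
  exists p e : nat, prime p /\ (0 < e)%N /\ q = (p ^ e)%N.

Definition fqpoly (F : fieldType) (q d : nat) (a : nat -> F) (y : F) : F :=
  \sum_(i < d.+1) a i * y ^+ (q ^ i)%N.

Definition gqpoly (F : fieldType) (q k : nat) (alpha beta : F) (x : F) : F :=
  alpha * x ^+ (q ^ k)%N + beta * x.

Definition supp (F : fieldType) (d : nat) (a : nat -> F) : seq nat :=
  [seq i <- iota 0 d.+1 | a i != 0].

Definition is_monomial (F : fieldType) d (a : nat -> F) := size (supp d a) == 1%N.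
Definition is_binomial (F : fieldType) d (a : nat -> F) := size (supp d a) == 2%N.

Definition ell (F : fieldType) d (a : nat -> F) : nat := head 0%N (supp d a).
Definition ell2 (F : fieldType) d (a : nat -> F) : nat :=
  head 0%N (behead (supp d a)).

Definition mh (F : fieldType) d (a : nat -> F) (beta : F) (h : nat) : nat :=
  if a h != beta then 0%N
  else if beta == 0 then (ell d a - h)%N
  else (ell2 d a - h)%N.

(* Equality of points <u> = <v> of PG(1, F) for nonzero vectors u, v in F^2 *)
Definition same_point (F : fieldType) (u v : F * F) : Prop :=
  exists c : F, c != 0 /\ u.1 = c * v.1 /\ u.2 = c * v.2.

(* Main.v *)
(** With [u = y ^ (q ^ h)] the claim becomes: [G u = alpha * x ^ (q ^ k - 1) * u]
    has a solution with [u, x] nonzero, where [G = \sum_(m <= i <= d - h) b_i X ^ (q ^ i)]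
    has [b_m] and [b_(d - h)] nonzero.  Equivalently, for [kap] the gcd of [q ^ k - 1]
    and [q ^ n - 1], the polynomial [f = alpha^-1 X ^ (kap - 1) G] takes a nonzero
    [kap]-th power as a value.  Being the [q ^ m]-th power of a separable polynomial,
    [G] has only [q ^ (d - h - m)] distinct roots, so this follows from Weil's bound
    [|\sum_u chi (f u)| <= (number of distinct roots of f - 1) * sqrt (q ^ n)]
    for the nontrivial characters [chi] of order dividing [kap].

    Weil's bound is obtained in the elementary way.  The sums of [chi] over monic
    polynomials of degree [j] vanish for large [j], so the character sums [S_j] over the
    extensions of degree [j] are, up to sign, the power sums of finitely many complex
    numbers [w].  Stepanov's method gives [S_(2i) = O(q ^ (n i))] with a crude constant,
    hence [|w| <= sqrt (q ^ n)], and the case [j = 1] is the sharp bound. *)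
Require Import Defs.
From HB Require Import structures.
From mathcomp Require Import all_boot all_order all_algebra all_field all_solvable.
From mathcomp Require Import zify ring lra.
Set Implicit Arguments. Unset Strict Implicit. Unset Printing Implicit Defensive.
Import Order.TTheory GRing.Theory Num.Theory.
Local Open Scope ring_scope.

(** * Power sums and the size of the roots *)

(** Newton's identities: compare coefficients in [X A' = - A \sum_w w X / (1 - w X)]. Induction on
    [s] avoids power series. *)
Lemma newton_prod (R : comNzRingType) (s : seq R) (n : nat) :
  let A : {poly R} := \prod_(w <- s) (1 - w *: 'X) in
  A`_n *+ n = - \sum_(i < n) (\sum_(w <- s) w ^+ i.+1) * A`_(n - i.+1).
Proof.
elim: s n => [|w s IHs] n /=.
  rewrite big_nil coefC big1 ?oppr0; last by move=> i _; rewrite big_nil mul0r.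
  by case: n => [|n]; rewrite ?mulr0n ?mul0rn.
set A := \prod_(w <- s) _ in IHs *.
have cA k : (\prod_(v <- w :: s) (1 - v *: 'X))`_k
    = A`_k - w * (if k is k'.+1 then A`_k' else 0).
  rewrite big_cons mulrBl mul1r coefB -scalerAl coefZ -/A.
  by congr (_ - _ * _); rewrite coefXM; case: k.
rewrite cA; case: n => [|n]; first by rewrite mulr0n big_ord0 oppr0.
have -> : \sum_(i < n.+1) (\sum_(v <- w :: s) v ^+ i.+1) *
     (\prod_(v <- w :: s) (1 - v *: 'X))`_(n.+1 - i.+1) =
   \sum_(i < n.+1) (\sum_(v <- s) v ^+ i.+1) * A`_(n.+1 - i.+1)
   - w * (\sum_(i < n) (\sum_(v <- s) v ^+ i.+1) * A`_(n - i.+1))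
   + w * A`_n.
  transitivity (\sum_(i < n.+1) ((\sum_(v <- s) v ^+ i.+1) * A`_(n.+1 - i.+1)
     - w * (if (n - i)%N is k.+1 then (\sum_(v <- s) v ^+ i.+1) * A`_k else 0)
     + (w ^+ i.+1 * A`_(n - i) -
         (if (n - i)%N is k.+1 then w ^+ i.+2 * A`_k else 0)))).
    apply: eq_bigr => i _; rewrite subSS cA big_cons.
    by case: (n - i)%N => [|k]; rewrite ?exprS; ring.
  rewrite big_split /= big_split /=; congr (_ + _ + _).
    rewrite sumrN -mulr_sumr big_ord_recr /= subnn addr0.
    congr (- (_ * _)); apply: eq_bigr => i _.
    by rewrite -(subnSK (ltn_ord i)).
  (* The powers of the new root [w] contribute [(u 0 - u 1) + (u 1 - u 2) + ...], which telescopes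
     to [u 0]. *)
  pose u k := w ^+ k.+1 * A`_(n - k).
  rewrite (eq_bigr (fun i : 'I_n.+1 => u i - (if (i < n)%N then u i.+1 else 0))); last first.
    move=> i _; rewrite /u; congr (_ - _); case: ltnP => h.
      by rewrite -(subnSK h).
    by rewrite (eqP (_ : n - i == 0)%N) // subn_eq0.
  rewrite -(big_mkord predT (fun i => u i - (if (i < n)%N then u i.+1 else 0))).
  rewrite big_nat_recr //= ltnn subr0 big_nat.
  rewrite (eq_bigr (fun i => - (u i.+1 - u i))); last by move=> i /andP[_ ->]; rewrite opprB.
  by rewrite -big_nat sumrN telescope_sumr // /u subn0 expr1 opprB subrK.
have h1 := IHs n.+1; have h2 := IHs n; rewrite /= -/A in h1 h2.
set S1 := \sum_(i < n.+1) _; set S2 := \sum_(i < n) _.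
by rewrite mulrnBl h1 -mulrnAr mulrSr h2 -/S1 -/S2; ring.
Qed.

(** By Bernoulli's inequality, the powers of some [x > 1] would exceed any bound. *)
Lemma bounded_expn_le1 (R : archiNumFieldType) (x C : R) :
  0 <= x -> (forall i : nat, x ^+ i <= C) -> x <= 1.
Proof.
move=> x0 hC; rewrite real_leNgt ?ger0_real //; apply/negP => x1.
have bern i : 1 + (x - 1) *+ i <= x ^+ i.
  elim: i => [|i IHi]; first by rewrite mulr0n addr0.
  have := ler_wpM2l x0 IHi; rewrite -exprS; apply: le_trans.
  rewrite -subr_ge0.
  have -> : x * (1 + (x - 1) *+ i) - (1 + (x - 1) *+ i.+1) = (x - 1) ^+ 2 *+ i.
    by rewrite mulrSr -[(x - 1) *+ i]mulr_natr -[_ *+ i]mulr_natr; ring.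
  by rewrite mulrn_wge0 // exprn_ge0 // subr_ge0 ltW.
have C0 : 0 <= C by apply: le_trans (hC 0); rewrite expr0.
have d0 : 0 < x - 1 by rewrite subr_gt0.
have := archi_boundP (divr_ge0 C0 (ltW d0)).
rewrite ltr_pdivrMr // => h.
have := le_trans (bern (Num.Def.archi_bound (C / (x - 1)))) (hC _).
rewrite -mulr_natl => h2; have := lt_le_trans h (le_trans _ h2).
by rewrite lerDr ler01 ltxx => /(_ isT).
Qed.

(** Large values cannot hide by cancellation: a fixed combination of consecutive power sums is a
    nonzero multiple of [w ^+ i]. *)
Lemma power_sum_growth (R : archiNumFieldType) (s : seq R) (b C : R) (i0 : nat) :
  0 < b -> (forall i, (i0 <= i)%N -> `|\sum_(w <- s) w ^+ i| <= C * b ^+ i) ->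
  forall w, w \in s -> `|w| <= b.
Proof.
move=> b0 hb w ws; have [->|w0] := eqVneq w 0; first by rewrite normr0 ltW.
(* The Lagrange polynomial [L] of the other values isolates [w]. *)
pose t := [seq v <- undup s | v != w].
pose L := \prod_(v <- t) ('X - v%:P).
have Lw : L.[w] != 0.
  by rewrite -rootE root_prod_XsubC mem_filter eqxx.
have Lv v : v \in s -> v != w -> L.[v] = 0.
  move=> vs vw; apply/eqP; rewrite -rootE root_prod_XsubC mem_filter vw.
  by rewrite mem_undup.
have key i : \sum_(k < size L) L`_k * (\sum_(v <- s) v ^+ (i + k)) =
     (w ^+ i * L.[w]) *+ count_mem w s.
  under eq_bigr => k _ do rewrite mulr_sumr.
  rewrite exchange_big /=.
  transitivity (\sum_(v <- s) if v == w then w ^+ i * L.[w] else 0).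
    apply: eq_big_seq => v vs.
    transitivity (v ^+ i * L.[v]).
      rewrite horner_coef mulr_sumr; apply: eq_bigr => k _.
      by rewrite exprD; ring.
    by case: eqVneq => [->//|vw]; rewrite Lv ?mulr0.
  by rewrite -big_mkcond big_const_seq iter_addr addr0.
pose C1 := (\sum_(k < size L) `|L`_k| * C * b ^+ k) / `|L.[w]|.
have nL : 0 < `|L.[w]| by rewrite normr_gt0.
have bd i : (i0 <= i)%N -> `|w| ^+ i <= C1 * b ^+ i.
  move=> i0i; rewrite mulrAC ler_pdivlMr // -normrX -normrM.
  (* The multiplicity of [w] is at least one, so dropping it only decreases the norm. *)
  apply: le_trans (_ : `|(w ^+ i * L.[w]) *+ count_mem w s| <= _).
    rewrite normrMn -mulr_natr ler_peMr // ler1n -has_count.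
    by apply/hasP; exists w => /=.
  rewrite -key mulr_suml; apply: le_trans (ler_norm_sum _ _ _) _.
  apply: ler_sum => k _; rewrite normrM -!mulrA ler_wpM2l //.
  by rewrite -exprD addnC hb // addnC (leq_trans i0i) ?leq_addr.
pose x := `|w| / b; have x0 : 0 < x by rewrite divr_gt0 ?normr_gt0.
rewrite -[leRHS]mul1r -ler_pdivrMr // -/x.
apply: (@bounded_expn_le1 _ _ (C1 / x ^+ i0)); first exact: ltW.
move=> i; rewrite ler_pdivlMr ?exprn_gt0 // -exprD expr_div_n.
by rewrite ler_pdivrMr ?exprn_gt0 // bd // leq_addl.
Qed.

(* The [a i] are the coefficients of an L-polynomial and the [S j] the
   corresponding exponential sums: a bound of the expected order on [S] at all
   large even indices gives the sharp bound at index one. *)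
Lemma newton_sharp_bound (R : archiClosedFieldType) (a S : nat -> R) (d i0 : nat) (b C : R) :
  0 < b -> a 0%N = 1 -> (forall n, (d <= n)%N -> a n = 0) ->
  (forall n, a n *+ n = \sum_(i < n) S i.+1 * a (n - i.+1)%N) ->
  (forall i, (i0 <= i)%N -> `|S i.*2| <= C * b ^+ i) ->
  `|S 1%N| <= d.-1%:R * sqrtC b.
Proof.
move=> b0 a0 ad aS hS.
have d0 : (0 < d)%N.
  by case: d ad => // /(_ 0%N isT)/eqP; rewrite a0 oner_eq0.
pose A := \poly_(i < d) a i.
have A_coef n : A`_n = a n by rewrite coef_poly; case: ltnP => // /ad.
(* As [a 0 = 1], no root of [A] is zero, and [s] consists of the inverses of the roots. *)
have [s [As ss]] : exists s : seq R, A = \prod_(w <- s) (1 - w *: 'X) /\ (size s <= d.-1)%N.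
  have [r Ar] := closed_field_poly_normal A.
  have lA : lead_coef A != 0.
    by rewrite lead_coef_eq0; apply/eqP => A0; have := A_coef 0; rewrite A0 coef0 a0 => /eqP; rewrite eq_sym oner_eq0.
  have hA : lead_coef A * \prod_(z <- r) (- z) = 1.
    have : A.[0] = 1 by rewrite horner_coef0 A_coef.
    rewrite {1}Ar hornerZ horner_prod; apply: etrans; congr (_ * _).
    by apply: eq_bigr => z _; rewrite hornerXsubC sub0r.
  have rn z : z \in r -> z != 0.
    move=> zr; apply/eqP => z0; move/eqP: hA.
    by rewrite (big_rem z) //= z0 oppr0 mul0r mulr0 eq_sym oner_eq0.
  exists [seq z^-1 | z <- r]; split; last first.
    rewrite size_map; have := size_poly d a; rewrite -/A {1}Ar size_scale // size_prod_XsubC.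
    by case: (d) d0.
  rewrite {1}Ar big_map -[X in X *: _]mulr1 -[X in X *: _]mulr1.
  have -> : \prod_(z <- r) ('X - z%:P) = (\prod_(z <- r) (- z)) *: \prod_(z <- r) (1 - z^-1 *: 'X) .
    rewrite -mul_polyC rmorph_prod -big_split /=; apply: eq_big_seq => z /rn z0.
    by rewrite mul_polyC scalerBr scalerA mulNr mulfV // scaleN1r opprK alg_polyC polyCN addrC.
  by rewrite scalerA !mulr1 hA scale1r.
(* Both sides satisfy Newton's recurrence, which determines [S n] because its last term has
   coefficient [a 0 = 1]. *)
have SE n : (0 < n)%N -> S n = - \sum_(w <- s) w ^+ n.
  elim/ltn_ind: n => -[//|n] IHn _.
  have := newton_prod s n.+1; rewrite /= -As A_coef aS.
  rewrite big_ord_recr [in RHS]big_ord_recr /= subnn A_coef a0 !mulr1.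
  rewrite opprD -sumrN.
  rewrite (eq_bigr (fun i : 'I_n => - ((\sum_(w <- s) w ^+ i.+1) * A`_(n.+1 - i.+1)))).
    by move/addrI.
  by move=> i _; rewrite IHn ?mulNr ?A_coef // !ltnS.
have wb w : w \in s -> `|w| <= sqrtC b.
  have sb0 : 0 <= sqrtC b by rewrite sqrtC_ge0 ltW.
  move=> ws; rewrite -(@ler_pXn2r _ 2) ?nnegrE // sqrtCK -normrX.
  (* Only even indices are bounded, hence the passage to squares; the formula for [S] starts at
     index 1, hence [maxn 1]. *)
  apply: (@power_sum_growth _ [seq v ^+ 2 | v <- s] b C (maxn 1 i0)) => //; last first.
    by apply/mapP; exists w.
  move=> i; rewrite geq_max => /andP[i1 ii]; have := hS i ii.
  rewrite SE ?double_gt0 // normrN big_map.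
  by under [in X in _ -> X]eq_bigr => v _ do rewrite -exprM mul2n.
rewrite SE // normrN.
apply: le_trans (ler_norm_sum _ _ _) _.
apply: le_trans (_ : \sum_(w <- s) sqrtC b <= _).
  by rewrite !big_seq; apply: ler_sum => w ws; rewrite expr1 wb.
rewrite big_const_seq iter_addr addr0 count_predT -[leLHS]mulr_natl.
by apply: ler_wpM2r; [rewrite sqrtC_ge0 ltW | rewrite ler_nat].
Qed.

(** * Points and polynomials fixed by Frobenius *)

(** The characteristic hypothesis is an argument of the map, so that the ring morphism structure can
    be attached to [frob] itself. *)
Definition frob (R : comNzRingType) (p r : nat) of p \in [pchar R] :=
  fun x : R => x ^+ (p ^ r).

Section FrobeniusMorphism.
Variables (R : comNzRingType) (p r : nat) (pR : p \in [pchar R]).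

Lemma frobD : {morph frob r pR : x y / x + y}.
Proof.
move=> x y; rewrite /frob exprDn_pchar // pnatX; apply/orP; left.
by rewrite pnatE ?(pcharf_prime pR).
Qed.

Fact frob_is_zmod_morphism : zmod_morphism (frob r pR).
Proof.
have f0 : frob r pR 0 = 0 by rewrite /frob expr0n expn_eq0 -leqn0 leqNgt prime_gt0 ?(pcharf_prime pR).
have fN x : frob r pR (- x) = - frob r pR x.
  by apply/eqP; rewrite -addr_eq0 -frobD addNr f0.
by move=> x y; rewrite frobD fN.
Qed.

Fact frob_is_monoid_morphism : monoid_morphism (frob r pR).
Proof. by split=> [|x y]; rewrite /frob ?expr1n ?exprMn. Qed.

HB.instance Definition _ :=
  GRing.isZmodMorphism.Build R R (frob r pR) frob_is_zmod_morphism.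
HB.instance Definition _ :=
  GRing.isMonoidMorphism.Build R R (frob r pR) frob_is_monoid_morphism.

End FrobeniusMorphism.

Section Fixed.
Variables (K : closedFieldType) (p r : nat) (pK : p \in [pchar K]).
Hypothesis r_gt0 : (0 < r)%N.
Let q := (p ^ r)%N.
Let phi : {rmorphism K -> K} := frob r pK.

Lemma phiE x : phi x = x ^+ q. Proof. by []. Qed.

Lemma pexp_gt1 : (1 < q)%N.
Proof.
have p1 := prime_gt1 (pcharf_prime pK).
by rewrite -(exp1n r) ltn_exp2r.
Qed.

Lemma expq_gt0 j : (0 < q ^ j)%N.
Proof. by rewrite expn_gt0 ltnW ?pexp_gt1. Qed.

Lemma expq_gt1 j : (0 < j)%N -> (1 < q ^ j)%N.
Proof. by move=> j0; rewrite -[X in (X < _)%N](expn0 q) ltn_exp2l ?pexp_gt1. Qed.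

Lemma phi_iter j x : iter j phi x = x ^+ (q ^ j).
Proof.
elim: j => [|j IHj] /=; first by rewrite expn0 expr1.
by rewrite IHj phiE -exprM -expnSr.
Qed.

Lemma exprq_inj j : injective (fun x : K => x ^+ (q ^ j)).
Proof.
move=> x y /=; rewrite -!phi_iter; elim: j => [//|j IHj] /=.
by move/fmorph_inj/IHj.
Qed.

(* The subfield of [K] with [q ^ j] elements; meaningful for [0 < j] only. *)
Definition fixpts (j : nat) : seq K :=
  sval (closed_field_poly_normal ('X^(q ^ j) - 'X : {poly K})).

Lemma fixpts_prod j : (0 < j)%N ->
  'X^(q ^ j) - 'X = \prod_(z <- fixpts j) ('X - z%:P) :> {poly K}.
Proof.
move=> j0; rewrite /fixpts; case: closed_field_poly_normal => s /= {1}->.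
rewrite (_ : lead_coef _ = 1) ?scale1r // lead_coefDl ?lead_coefXn //.
by rewrite size_polyN size_polyXn size_polyX ltnS expq_gt1.
Qed.

Lemma mem_fixpts j x : (0 < j)%N -> (x \in fixpts j) = (x ^+ (q ^ j) == x).
Proof.
move=> j0; rewrite -root_prod_XsubC -fixpts_prod // rootE !hornerE.
by rewrite subr_eq0.
Qed.

Lemma size_fixpts j : (0 < j)%N -> size (fixpts j) = (q ^ j)%N.
Proof.
move=> j0; have := size_prod_XsubC (fixpts j) id; rewrite -fixpts_prod //.
rewrite size_polyDl ?size_polyXn => [[]//|].
by rewrite size_polyN size_polyX ltnS expq_gt1.
Qed.

Lemma natr_expq j : (0 < j)%N -> (q ^ j)%:R = 0 :> K.
Proof.
move=> j0; rewrite /q -expnM natrX (pcharf0 pK) expr0n.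
by rewrite gtn_eqF // muln_gt0 r_gt0.
Qed.

(** The derivative of [X^(q^j) - X] is the constant [-1]. *)
Lemma uniq_fixpts j : (0 < j)%N -> uniq (fixpts j).
Proof.
move=> j0; rewrite -separable_prod_XsubC -fixpts_prod // unlock.
rewrite derivB derivXn derivX -mulr_natr -polyC_natr natr_expq //.
by rewrite polyC0 mulr0 sub0r -(scaleN1r 1) coprimepZr ?oppr_eq0 ?oner_eq0 ?coprimep1.
Qed.

(** Stands for the polynomials over the field with [q] elements; the whole tower of fields is kept
    inside [K]. *)
Definition fixedp (h : {poly K}) := map_poly phi h == h.

Lemma fixedpP (h : {poly K}) : reflect (forall i, h`_i ^+ q = h`_i) (fixedp h).
Proof.
apply: (iffP eqP) => [hh i|hh]; last by apply/polyP => i; rewrite coef_map; apply: hh.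
by rewrite -[in RHS]hh coef_map.
Qed.

Lemma fixedp1 : fixedp 1. Proof. by rewrite /fixedp rmorph1. Qed.

Lemma fixedpM g h : fixedp g -> fixedp h -> fixedp (g * h).
Proof. by rewrite /fixedp rmorphM /= => /eqP-> /eqP->. Qed.

Lemma fixedpD g h : fixedp g -> fixedp h -> fixedp (g + h).
Proof. by rewrite /fixedp rmorphD /= => /eqP-> /eqP->. Qed.

Lemma fixedp_divl g h : g != 0 -> fixedp g -> fixedp (g * h) -> fixedp h.
Proof.
move=> g0; rewrite /fixedp rmorphM /= => /eqP-> /eqP/(mulfI g0)->; exact: eqxx.
Qed.

Lemma fixedp_horner j (h : {poly K}) x : fixedp h -> h.[x ^+ (q ^ j)] = h.[x] ^+ (q ^ j).
Proof.
move=> /eqP hh; elim: j => [|j IHj]; first by rewrite expn0 !expr1.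
by rewrite expnSr !exprM -IHj -!phiE -{1}hh horner_map.
Qed.

Lemma fixedp_prod (s : seq K) :
  perm_eq (map phi s) s -> fixedp (\prod_(z <- s) ('X - z%:P)).
Proof.
move=> ps; rewrite /fixedp map_prod_XsubC.
by rewrite -[X in _ == X](perm_big _ ps) /= big_map.
Qed.

Lemma fixedp_prod_perm c (s : seq K) : c != 0 ->
  fixedp (c *: \prod_(z <- s) ('X - z%:P)) -> perm_eq (map phi s) s.
Proof.
move=> c0 /eqP; rewrite linearZ /= map_prod_XsubC => e.
have /(congr1 lead_coef) := e.
rewrite !lead_coefZ !lead_coef_prod_XsubC !mulr1 => ec.
apply: prod_XsubC_eq; rewrite big_map.
by apply: (scalerI c0); rewrite -{1}ec.
Qed.

Lemma perm_phi_undup (s : seq K) : perm_eq (map phi s) s ->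
  perm_eq (map phi (undup s)) (undup s).
Proof.
move=> ps; rewrite -undup_map_inj; last exact: fmorph_inj.
by apply: uniq_perm; rewrite ?undup_uniq // => x; rewrite !mem_undup (perm_mem ps).
Qed.

(* The polynomials [b * 'X^n + h], with [h] of size at most [n] and coefficients
   in the field with [q] elements. *)
Fixpoint polyext (b : {poly K}) (n : nat) : seq {poly K} :=
  if n is n'.+1 then [seq 'X * hc.1 + hc.2%:P | hc <- allpairs pair (polyext b n') (fixpts 1)]
  else [:: b].

Lemma XMaddC_inj (g h : {poly K}) a b :
  'X * g + a%:P = 'X * h + b%:P -> g = h /\ a = b.
Proof.
move=> e; have e0 : a = b.
  by have /(congr1 (fun u : {poly K} => u`_0)) := e; rewrite !coefD !coefXM !coefC /= !add0r.
split=> //; move: e; rewrite e0 => /addIr /mulfI; apply.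
by rewrite polyX_eq0.
Qed.

Lemma uniq_polyext b n : uniq (polyext b n).
Proof.
elim: n => [//|n IHn] /=; rewrite map_inj_uniq.
  by rewrite allpairs_uniq ?uniq_fixpts // => -[? ?] [? ?].
by move=> [g a] [h c] /= /XMaddC_inj [-> ->].
Qed.

Lemma mem_polyext b n h : fixedp b ->
  (h \in polyext b n) = fixedp h && (drop_poly n h == b).
Proof.
move=> fb; elim: n h => [|n IHn] h /=.
  by rewrite inE drop_poly0l; case: eqP => [->|]; rewrite ?fb ?andbF.
have mem1 a : (a \in fixpts 1) = (a ^+ q == a) by rewrite mem_fixpts ?expn1.
apply/mapP/andP => [[[g a] /allpairsP[[g' a'] /= [gn aS [-> ->]]] ->]|[fh /eqP dh]].
  move: gn; rewrite IHn => /andP[fg /eqP dg].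
  have dX : drop_poly n.+1 ('X * g' + a'%:P) = drop_poly n g'.
    by apply/polyP => i; rewrite !coef_drop_poly coefD coefXM coefC addnS /= addr0.
  rewrite dX dg eqxx; split=> //; apply/fixedpP => -[|i].
    by rewrite coefD coefXM coefC /= add0r; apply/eqP; rewrite -mem1.
  by rewrite coefD coefXM coefC /= addr0; apply/fixedpP.
have eh : h = 'X * drop_poly 1 h + (h`_0)%:P.
  apply/polyP => -[|i]; rewrite coefD coefXM coefC /= ?add0r //.
  by rewrite coef_drop_poly addn1 addr0.
exists (drop_poly 1 h, h`_0) => //; apply: allpairs_f; last first.
  by rewrite mem1; apply/eqP/fixedpP.
rewrite IHn -dh; apply/andP; split.
  by apply/fixedpP => i; rewrite coef_drop_poly; apply/fixedpP.
by apply/eqP/polyP => i; rewrite !coef_drop_poly addn1 addnS.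
Qed.

Definition monics := polyext 1.

Lemma mem_monics n h :
  (h \in monics n) = [&& fixedp h, h \is monic & size h == n.+1].
Proof.
rewrite mem_polyext ?fixedp1 //; congr (_ && _); apply/eqP/andP => [dh|[mh /eqP sh]].
  have := poly_take_drop n h; rewrite dh mul1r => <-.
  have lt : (size (take_poly n h) < size ('X^n : {poly K}))%N.
    by rewrite size_polyXn ltnS size_take_poly.
  by rewrite monicE addrC lead_coefDl // lead_coefXn eqxx size_polyDl // size_polyXn.
apply/polyP => -[|i]; rewrite coef_drop_poly coef1 /=.
  by have := monicP mh; rewrite lead_coefE sh.
by rewrite nth_default // sh addSn ltnS leq_addl.
Qed.

Definition lows := polyext 0.

Lemma mem_lows n h : (h \in lows n) = fixedp h && (size h <= n)%N.
Proof.
have f0 : fixedp 0 by rewrite /fixedp rmorph0.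
rewrite mem_polyext //; congr (_ && _); apply/eqP/idP => [dh|]; last exact: drop_poly_eq0.
have := poly_take_drop n h; rewrite dh mul0r addr0 => <-.
exact: size_take_poly.
Qed.

(** For [b] in the field with [q ^ j] elements, this is its characteristic polynomial over the field
    with [q] elements, a power of its minimal polynomial. *)
Definition orbpoly (j : nat) (b : K) : {poly K} :=
  \prod_(i < j) ('X - (b ^+ (q ^ i))%:P).

Lemma orbpoly_monic j b : orbpoly j b \is monic.
Proof. exact: monic_prod_XsubC. Qed.

Lemma orbpolyE j b :
  orbpoly j b = \prod_(z <- [seq b ^+ (q ^ i) | i <- iota 0 j]) ('X - z%:P).
Proof. by rewrite /orbpoly big_map -(big_mkord predT (fun i => 'X - (b ^+ (q ^ i))%:P)) /index_iota subn0. Qed.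

Lemma size_orbpoly j b : size (orbpoly j b) = j.+1.
Proof. by rewrite orbpolyE size_prod_XsubC size_map size_iota. Qed.

Lemma fixedp_orbpoly j b : b ^+ (q ^ j) = b -> fixedp (orbpoly j b).
Proof.
case: j => [|j] bj; first by rewrite /orbpoly big_ord0 fixedp1.
rewrite orbpolyE; apply: fixedp_prod.
have -> : map phi [seq b ^+ (q ^ i) | i <- iota 0 j.+1] =
    [seq b ^+ (q ^ i.+1) | i <- iota 0 j.+1].
  rewrite -map_comp; apply: eq_map => i.
  by apply: (@etrans _ _ ((b ^+ (q ^ i)) ^+ q)) => //; rewrite -exprM -expnSr.
have -> : [seq b ^+ (q ^ i.+1) | i <- iota 0 j.+1] =
    rcons [seq b ^+ (q ^ i) | i <- iota 1 j] b.
  transitivity [seq b ^+ (q ^ i) | i <- iota 1 j.+1].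
    by rewrite (iotaDl 1 0) -map_comp.
  have -> : iota 1 j.+1 = rcons (iota 1 j) j.+1.
    by rewrite -[in LHS](addn1 j) iotaD cats1 add1n.
  by rewrite map_rcons bj.
by rewrite perm_rcons /= expn0 expr1.
Qed.

Lemma root_orbpoly j b : (0 < j)%N -> root (orbpoly j b) b.
Proof.
case: j => // j _; rewrite orbpolyE root_prod_XsubC /= expn0 expr1 inE eqxx.
by [].
Qed.

Lemma orbpolyD i j b : b ^+ (q ^ i) = b ->
  orbpoly (i + j) b = orbpoly i b * orbpoly j b.
Proof.
move=> bi; rewrite !orbpolyE iotaD map_cat big_cat add0n; congr (_ * _).
rewrite -[X in iota X j]addn0 iotaDl -map_comp; congr (\prod_(z <- _) _); apply: eq_map => k /=.
by rewrite expnD exprM bi.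
Qed.

(** If the root [b] has degree [D], the exponents [j] that fix [b] are the multiples [k D], and
    [orbpoly (k D) b] is the [k]-th power of the minimal polynomial; it divides [h] exactly when
    [k <= mup b h]. The induction strips one minimal polynomial. *)
Lemma count_orbpoly_dvd (h : {poly K}) (b : K) n :
  fixedp h -> h \is monic -> ((size h).-1 <= n)%N ->
  \sum_(1 <= j < n.+1) ((b ^+ (q ^ j) == b) && (orbpoly j b %| h) : nat) = mup b h.
Proof.
elim/ltn_ind: n h => n IHn h fh mh hn.
have h0 : h != 0 by rewrite monic_neq0.
have [rb|nrb] := boolP (root h b); last first.
  rewrite mupNroot // big_nat big1 // => j /andP[j0 _].
  apply/eqP; rewrite eqb0 negb_and; apply/orP; right.
  apply: contra nrb => dv; apply: (root_dvdp dv); exact: root_orbpoly.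
(* The conjugates [b ^+ (q ^ i)] are all roots of [h], so two of them coincide and the degree [D] of
   [b] exists. *)
have [D [D0 bD minD]] : exists D, [/\ (0 < D)%N, b ^+ (q ^ D) = b &
    forall j, (0 < j)%N -> b ^+ (q ^ j) = b -> (D <= j)%N].
  have ex : exists j, (0 < j)%N && (b ^+ (q ^ j) == b).
    pose s := [seq b ^+ (q ^ i) | i <- iota 0 (size h)].
    have nus : ~~ uniq s.
      apply/negP => us; have := max_poly_roots h0 (_ : all (root h) s) us.
      rewrite size_map size_iota ltnn => e; have : false by apply: e; apply/allP => z /mapP[i _ ->];
        rewrite rootE fixedp_horner // (rootP rb) expr0n gtn_eqF // expq_gt0.
      by [].
    have /(uniqPn 0)[i [j [ij]]] := nus.
    rewrite size_map size_iota => js.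
    rewrite !(nth_map 0%N) ?size_iota ?(ltn_trans ij) // !nth_iota ?(ltn_trans ij) // !add0n => e.
    exists (j - i)%N; rewrite subn_gt0 ij; apply/eqP/(@exprq_inj i).
    by rewrite /= -exprM -expnD subnK // ltnW.
  case: (ex_minnP ex) => D /andP[D0 /eqP bD] mD; exists D; split=> // j j0 bj.
  by apply: mD; rewrite j0 bj eqxx.
have uorb : uniq [seq b ^+ (q ^ i) | i <- iota 0 D].
  rewrite map_inj_in_uniq ?iota_uniq // => i j.
  rewrite !mem_iota !add0n /=.
  wlog ij : i j / (i <= j)%N => [wl iD jD e|].
    by case: (leqP i j) => h'; [apply: wl | symmetry; apply: wl => //; apply: ltnW].
  move=> iD jD e; move: ij; rewrite leq_eqVlt => /orP[/eqP //|ij].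
  have bji : b ^+ (q ^ (j - i)) = b.
    by apply/(@exprq_inj i); rewrite /= -exprM -expnD subnK ?(ltnW ij).
  have := minD (j - i)%N; rewrite subn_gt0 ij bji => /(_ isT erefl).
  by rewrite leqNgt (leq_ltn_trans _ jD) // leq_subr.
have dvD : orbpoly D b %| h.
  rewrite orbpolyE; apply: uniq_roots_dvdp; last by rewrite uniq_rootsE.
  by apply/allP => z /mapP[i _ ->]; rewrite rootE fixedp_horner // (rootP rb) expr0n gtn_eqF // expq_gt0.
have [g eh] : exists g, h = orbpoly D b * g.
  by move/dvdpP: dvD => [g ->]; exists g; rewrite mulrC.
have mg : g \is monic by rewrite -(monicMl _ (orbpoly_monic D b)) -eh.
have fg : fixedp g.
  apply: (@fixedp_divl (orbpoly D b)); rewrite ?monic_neq0 ?orbpoly_monic //.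
    exact: fixedp_orbpoly.
  by rewrite -eh.
have sh : (size h).-1 = (D + (size g).-1)%N.
  rewrite eh size_monicM ?orbpoly_monic ?monic_neq0 // size_orbpoly.
  by have : (0 < size g)%N; [rewrite size_poly_gt0 monic_neq0 | lia].
have Dn : (D <= n)%N by rewrite (leq_trans _ hn) // sh leq_addr.
rewrite (big_cat_nat (n := D)) //=; last by rewrite ltnW.
rewrite big_nat big1 ?add0n; last first.
  move=> j /andP[j0 jD]; apply/eqP; rewrite eqb0 negb_and; apply/orP; left.
  by apply/negP => /eqP /(minD _ j0); rewrite leqNgt jD.
rewrite big_ltn // bD eqxx dvD /=.
have -> : mup b h = (1 + mup b g)%N.
  rewrite eh mupM ?monic_neq0 ?orbpoly_monic //; congr (_ + _)%N.
  rewrite orbpolyE mu_prod_XsubC count_uniq_mem //.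
  by case: (D) D0 => // D' _; rewrite /= expn0 expr1 inE eqxx.
rewrite add1n; congr _.+1.
rewrite -(IHn (n - D)%N _ g) //; last 2 first.
- by rewrite -subn_gt0 subKn.
- by rewrite leq_subRL // -sh.
rewrite -{1}(add1n D) big_addn subSn // big_nat [RHS]big_nat.
apply: eq_bigr => j /andP[j0 _].
rewrite addnC orbpolyD // eh dvdp_mul2l ?monic_neq0 ?orbpoly_monic //.
by rewrite expnD exprM bD.
Qed.

(** The multiplicities of the roots of [h] add up to its degree. This spreads the weight [n] of [h]
    in the derivative of the L-series over Frobenius orbits. *)
Lemma sum_orbpoly_dvd n h : h \in monics n ->
  \sum_(1 <= j < n.+1) \sum_(b <- fixpts j) ((orbpoly j b %| h)%R : nat) = n.
Proof.
rewrite mem_monics => /and3P[fh mh /eqP sh].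
have [rs hrs] := closed_field_poly_normal h; rewrite (monicP mh) scale1r in hrs.
have srs : size rs = n.
  by move: sh; rewrite hrs size_prod_XsubC => -[].
transitivity (\sum_(b <- undup rs) mup b h); last first.
  rewrite -srs -sum1_size -[RHS]big_undup_iterop_count; apply: eq_bigr => b _.
  by rewrite hrs mu_prod_XsubC; case: (count_mem b rs) => [|[|c]] //=; elim: c => //= c ->.
rewrite (eq_bigr (fun b => \sum_(1 <= j < n.+1)
    ((b ^+ (q ^ j) == b) && (orbpoly j b %| h) : nat))); last first.
  by move=> b _; rewrite -(@count_orbpoly_dvd h b n) // sh.
rewrite [RHS]exchange_big; apply: eq_big_nat => j /andP[j0 _] /=.
have cl (s : seq K) (P : pred K) : \sum_(b <- s) (P b : nat) = \sum_(b <- [seq b <- s | P b]) 1%N.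
  by rewrite big_filter [RHS]big_mkcond; apply: eq_bigr => b _; case: (P b).
rewrite !cl; apply: perm_big; apply: uniq_perm.
- by rewrite filter_uniq ?uniq_fixpts.
- by rewrite filter_uniq ?undup_uniq.
move=> b; rewrite !mem_filter mem_fixpts // mem_undup.
case: (b ^+ _ == b); rewrite ?andbF //= andbT; case: (boolP (_ %| h)) => // dv.
rewrite -(@root_prod_XsubC K) -hrs; apply/esym.
exact: (root_dvdp dv (root_orbpoly _ j0)).
Qed.

(** * Euler product of a multiplicative function on monic polynomials *)

Section EulerProduct.
Variables (C : comNzRingType) (chi : {poly K} -> C).
Hypothesis chiM : forall g h, fixedp g -> fixedp h -> g \is monic -> h \is monic ->
  chi (g * h) = chi g * chi h.

(** The coefficients of the L-series of [chi]; [point_sum] gives those of its logarithmic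
    derivative. *)
Definition monic_sum n := \sum_(h <- monics n) chi h.
Definition point_sum j := \sum_(b <- fixpts j) chi (orbpoly j b).

(* Logarithmic derivative of the Euler product, with Frobenius orbits playing
   the role of the monic irreducible polynomials. *)
Lemma monic_sum_newton n :
  monic_sum n *+ n = \sum_(i < n) point_sum i.+1 * monic_sum (n - i.+1).
Proof.
transitivity (\sum_(h <- monics n) \sum_(1 <= j < n.+1) \sum_(b <- fixpts j)
    (if orbpoly j b %| h then chi h else 0)).
  rewrite /monic_sum -sumrMnl; apply: eq_big_seq => h hn.
  rewrite -{1}(sum_orbpoly_dvd hn) -sumrMnr; apply: eq_bigr => j _.
  by rewrite -sumrMnr; apply: eq_bigr => b _; case: (_ %| _).
rewrite exchange_big /= big_add1 /= big_mkord; apply: eq_bigr => i _.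
rewrite exchange_big /= /point_sum mulr_suml; apply: eq_big_seq => b.
rewrite mem_fixpts // => /eqP bi; set P := orbpoly _ b.
have fP : fixedp P by apply: fixedp_orbpoly.
have mP : P \is monic by apply: orbpoly_monic.
(* The monic multiples of [P] of degree [n] are the [P * h] with [h] monic of the complementary
   degree. *)
rewrite -big_mkcond /monic_sum mulr_sumr.
rewrite (eq_big_seq (fun h => chi (P * h))); last first.
  by move=> h; rewrite mem_monics => /and3P[fh mh _]; rewrite chiM.
rewrite -(big_map (fun h => P * h) predT chi) -big_filter; apply: perm_big.
apply: uniq_perm.
- by rewrite filter_uniq ?uniq_polyext.
- rewrite map_inj_uniq ?uniq_polyext //; apply: mulfI; exact: monic_neq0.
move=> h; rewrite mem_filter mem_monics.
apply/andP/mapP => [[/dvdpP[g eh] /and3P[fh mh /eqP sh]]|[g]].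
  have mg : g \is monic by rewrite -(monicMr _ mP) -eh.
  exists g; last by rewrite mulrC.
  rewrite mem_monics mg; apply/and3P; split=> //.
    by apply: (@fixedp_divl P); rewrite ?monic_neq0 // mulrC -eh.
  move: sh; rewrite eh size_monicM ?monic_neq0 // size_orbpoly.
  have : (0 < size g)%N by rewrite size_poly_gt0 monic_neq0.
  by have := ltn_ord i; move=> *; apply/eqP; lia.
rewrite mem_monics => /and3P[fg mg /eqP sg] ->; split; first exact: dvdp_mulIl.
rewrite fixedpM // monicMl // mg size_monicM ?monic_neq0 // size_orbpoly sg /=.
by have := ltn_ord i; move=> *; apply/eqP; lia.
Qed.

End EulerProduct.

End Fixed.

(** * Stepanov's method *)

Lemma poly_family_dependent (F : fieldType) (I : finType) (T : I -> {poly F}) (W : nat) :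
  (forall i, (size (T i) <= W)%N) -> (W < #|I|)%N ->
  exists c : I -> F, (exists i, c i != 0) /\ \sum_i c i *: T i = 0.
Proof.
move=> sT WI.
pose M := \matrix_(i < #|I|, j < W) (T (enum_val i))`_j.
have : kermx M != 0.
  rewrite kermx_eq0 /row_free neq_ltn; apply/orP; left.
  by apply: leq_ltn_trans WI; exact: rank_leq_col.
case/rowV0Pn => u /sub_kermxP uM u0.
exists (fun i => u 0 (enum_rank i)); split.
  by case/rV0Pn: u0 => j uj; exists (enum_val j); rewrite enum_valK.
apply/polyP => k; rewrite coef0 coef_sum.
have [kW|Wk] := ltnP k W; last first.
  by rewrite big1 // => i _; rewrite coefZ nth_default ?mulr0 // (leq_trans (sT i)).
have /matrixP/(_ 0 (Ordinal kW)) := uM; rewrite !mxE; apply: etrans.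
rewrite (reindex_onto enum_val enum_rank) /=; last by move=> i _; rewrite enum_rankK.
apply: eq_big => [i|i _]; first by rewrite enum_valK eqxx.
by rewrite !mxE coefZ enum_valK.
Qed.

(** In a relation, the term of least order at [v] cannot be cancelled: divide by that power of
    ['X - v] and evaluate at [v]. *)
Lemma distinct_orders_free (F : fieldType) (I : finType) (v : F) (o : I -> nat)
    (V : I -> {poly F}) (c : I -> F) :
  injective o -> (forall i, (V i).[v] != 0) ->
  \sum_i c i *: (('X - v%:P) ^+ o i * V i) = 0 -> forall i, c i = 0.
Proof.
move=> oi Vv s0 i; apply/eqP/negP => /negP ci.
case: (arg_minnP (P := fun i => c i != 0) o ci) => j cj minj.
have : \sum_k c k *: (('X - v%:P) ^+ o k * V k) =
  ('X - v%:P) ^+ o j * (c j *: V j + ('X - v%:P) * \sum_(k | k != j)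
     c k *: (('X - v%:P) ^+ (o k - o j).-1 * V k)).
  rewrite (bigD1 j) //= mulrDr scalerAr; congr (_ + _).
  rewrite mulrA -exprSr mulr_sumr; apply: eq_bigr => k kj.
  have [->|ck] := eqVneq (c k) 0; first by rewrite !scale0r mulr0.
  have ok : (o j < o k)%N.
    by rewrite ltn_neqAle minj // andbT; apply: contra kj => /eqP/oi ->.
  rewrite -scalerAr mulrA -exprD; congr (_ *: (_ ^+ _ * _)).
  by move: ok; lia.
rewrite s0 => /esym/eqP; rewrite mulf_eq0 expf_eq0 polyXsubC_eq0 andbF /= => /eqP.
move/(congr1 (fun u => u.[v])); rewrite !hornerE subrr mul0r addr0 => /eqP.
by rewrite mulf_eq0 (negPf cj) (negPf (Vv j)).
Qed.

Lemma size_exp_leq (R : idomainType) (g : {poly R}) n d :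
  ((size g).-1 <= d)%N -> (size (g ^+ n)%R <= (d * n).+1)%N.
Proof.
move=> gd; apply: leq_trans (size_poly_exp_leq g n) _.
by rewrite ltnS leq_mul2r gd orbT.
Qed.

Lemma size_mul_leqD (R : nzRingType) (g h : {poly R}) a b :
  (size g <= a.+1)%N -> (size h <= b.+1)%N -> (size (g * h)%R <= (a + b).+1)%N.
Proof.
move=> ga hb; apply: leq_trans (size_polyMleq g h) _; lia.
Qed.

Section Stepanov.
Variables (K : closedFieldType) (p r : nat) (pK : p \in [pchar K]).
Hypothesis r_gt0 : (0 < r)%N.
Let q := (p ^ r)%N.
Variables (kap : nat) (f : {poly K}) (v0 : K).
Hypothesis kap_gt0 : (0 < kap)%N.
Hypothesis f_neq0 : f != 0.
Hypothesis f_fixed : fixedp r pK f.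
Let mu := mup v0 f.
Let delta := (size f).-1.
Hypothesis mu_coprime : coprime mu kap.

Lemma stepanov_step (i M0 A B : nat) (a : K) :
  (0 < i)%N -> (q ^ i)%N = (kap * M0).+1 -> (kap * (A + mu) <= q ^ i)%N ->
  (delta * q ^ i + A * q ^ i + B < kap * B * A)%N -> a != 0 ->
  (count (fun b => f.[b] ^+ (M0 * (q ^ i).+1) == a) (fixpts K p r i.*2) <=
     delta * q ^ i + A + B * q ^ i)%N.
Proof.
set nu := (q ^ i)%N => i0 nuE kA W_lt a0.
(* At a point [b] of the set to be counted, put [y := b ^+ nu], so that
   [b = y ^+ nu] and [f.[b] ^+ M0 * f.[y] ^+ M0 = a]: up to the factor
   [f.[y] ^+ (kap.-1 * M0)], the value of [U t] at [b] is that of the low degree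
   polynomial [T t] at [y].  A linear relation between the [T t] thus produces a
   combination [Z] of the [U t] vanishing at all these points, and [Z != 0] because
   the [U t] have distinct orders at [v0]. *)
pose I := ('I_kap * 'I_B * 'I_A)%type.
pose T (t : I) := a ^+ t.1.1 *: (f ^+ ((kap.-1 - t.1.1) * M0) *
   (('X - (v0 ^+ nu)%:P) ^+ t.1.2 * ('X^nu - v0%:P) ^+ t.2)).
pose U (t : I) := f ^+ (t.1.1 * M0) * ('X - v0%:P) ^+ (nu * t.1.2 + t.2).
have nu0 : (0 < nu)%N by rewrite nuE.
have sT t : (size (T t) <= delta * nu + A * nu + B)%N.
  case: t => [[j l] k]; rewrite /T /=; apply: leq_trans (size_scale_leq _ _) _.
  have /leq_trans -> // : (size (f ^+ ((kap.-1 - j) * M0) *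
   (('X - (v0 ^+ nu)%:P) ^+ l * ('X^nu - v0%:P) ^+ k))%R <= (delta * ((kap.-1 - j) * M0) + (1 * l + nu * k)).+1)%N.
    apply: size_mul_leqD; first exact: size_exp_leq.
    apply: size_mul_leqD; first by apply: size_exp_leq; rewrite size_XsubC.
    by apply: size_exp_leq; rewrite size_XnsubC.
  have h1 : (delta * ((kap.-1 - j) * M0) <= delta * nu)%N.
    rewrite leq_mul2l nuE; apply/orP; right; apply: leqW.
    by rewrite leq_mul2r; apply/orP; right; lia.
  have h2 : (nu * k <= A * nu)%N by rewrite mulnC leq_mul2r ltnW ?orbT.
  have := ltn_ord l; lia.
have [c [[t0 ct0] cT]] : exists c : I -> K, (exists t, c t != 0) /\ \sum_t c t *: T t = 0.
  apply: poly_family_dependent sT _.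
  by rewrite !card_prod !card_ord.
pose Z := \sum_t c t *: U t.
have [f1 fE f1v] : exists2 f1, f = ('X - v0%:P) ^+ mu * f1 & f1.[v0] != 0.
  have := @mup_geq _ v0 f mu f_neq0; rewrite leqnn => /esym/dvdpP[f1 f1E].
  exists f1; first by rewrite mulrC.
  apply/negP => /eqP/rootP/factor_theorem[f2 f2E].
  have := @mup_geq _ v0 f mu.+1 f_neq0; rewrite ltnn => /esym/negP; apply.
  by apply/dvdpP; exists f2; rewrite f1E f2E exprS mulrA.
have Z0 : Z != 0.
  apply/eqP => Z0; move/eqP: ct0; apply.
  pose o (t : I) := (t.1.1 * M0 * mu + (nu * t.1.2 + t.2))%N.
  apply: (@distinct_orders_free _ _ v0 o (fun t => f1 ^+ (t.1.1 * M0)) c).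
  (* Since [kap * M0 = nu - 1], [kap] times the order is [(kap * l + j * mu) * nu + kap * k - j *
     mu]. By [kA] the base [nu] digits do not overlap, so [kap * l + j * mu] is determined, and then
     [j] modulo [kap] because [mu] is prime to [kap]. *)
  - move=> [[j l] k] [[j' l'] k']; rewrite /o /= => e.
    have [-> -> ->] // : [/\ j = j', l = l' & k = k'].
    have lj := ltn_ord j; have lj' := ltn_ord j'.
    have lk := ltn_ord k; have lk' := ltn_ord k'.
    have bd (k1 j1 : nat) : (k1 < A)%N -> (j1 < kap)%N -> (kap * k1 + j1 * mu < nu)%N.
      move=> k1A j1k; apply: leq_trans kA; rewrite mulnDr -addSn leq_add //.
        by rewrite ltn_pmul2l.
      by rewrite leq_mul2r ltnW ?orbT.
    have eX : (kap * l + j * mu)%N = (kap * l' + j' * mu)%N.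
      have e1 : ((kap * l + j * mu) * nu + (kap * k + j' * mu) =
                (kap * l' + j' * mu) * nu + (kap * k' + j * mu))%N.
        by move: e; rewrite nuE; nia.
      have := congr1 (divn^~ nu) e1.
      by rewrite !divnMDl // !(divn_small (bd _ _ _ _)) ?addn0.
    have ej : j = j'.
      apply/val_inj => /=; rewrite -(modn_small lj) -(modn_small lj'); apply/eqP.
      have := congr1 (modn^~ kap) eX.
      rewrite !(mulnC kap) !modnMDl => /eqP.
      wlog jj : j j' {e lj lj' eX} / (j' <= j)%N => [wl h|].
        by case: (leqP j' j) => h'; [exact: wl | rewrite eq_sym; apply: wl; rewrite 1?eq_sym // ltnW].
      rewrite eqn_mod_dvd ?leq_mul2r ?jj ?orbT // -mulnBl Gauss_dvdl 1?coprime_sym //.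
      by rewrite -eqn_mod_dvd.
    move: eX e; rewrite ej => /addIn/eqP; rewrite eqn_pmul2l // => /eqP el.
    by rewrite el => /addnI/addnI ek; split=> //; exact/val_inj.
  - by move=> t; rewrite horner_exp expf_neq0.
  - rewrite -[RHS]Z0; apply: eq_bigr => t _; congr (_ *: _).
    by rewrite /U {1}fE exprMn -exprM mulrAC -exprD (mulnC mu).
have sZ : (size Z <= (delta * nu + A + B * nu).+1)%N.
  apply: leq_trans (size_sum _ _ _) _; apply/bigmax_leqP => -[[j l] k] _.
  rewrite /U /=; apply: leq_trans (size_scale_leq _ _) _.
  have /leq_trans -> // : (size (f ^+ (j * M0) * ('X - v0%:P) ^+ (nu * l + k))%R <=
       (delta * (j * M0) + (1 * (nu * l + k))).+1)%N.
    apply: size_mul_leqD; first exact: size_exp_leq.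
    by apply: size_exp_leq; rewrite size_XsubC.
  have h1 : (delta * (j * M0) <= delta * nu)%N.
    rewrite leq_mul2l nuE; apply/orP; right; apply: leqW.
    by rewrite leq_mul2r ltnW ?orbT.
  have h2 : (nu * l <= B * nu)%N by rewrite mulnC leq_mul2r ltnW ?orbT.
  have := ltn_ord k; lia.
have i2 : (0 < i.*2)%N by rewrite double_gt0.
have M00 : (0 < M0)%N.
  by case: (M0) nuE (expq_gt1 pK r_gt0 i0) => // nuE'; rewrite -/q -/nu nuE' muln0.
rewrite -size_filter -ltnS; apply: leq_trans sZ; apply: max_poly_roots => //; last first.
  by rewrite filter_uniq // uniq_fixpts.
apply/allP => b; rewrite mem_filter mem_fixpts // -addnn expnD exprM -/nu.
move=> /andP[/eqP fb /eqP bb].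
pose y := b ^+ nu.
have fy : f.[y] = f.[b] ^+ nu by exact: (@fixedp_horner K p r pK i f b f_fixed).
have fb0 : f.[b] != 0.
  apply/eqP => f0; move: fb; rewrite f0 expr0n.
  by rewrite gtn_eqF ?M00 // mulr0n expr0n => ea; rewrite -ea eqxx in a0.
have fy0 : f.[y] ^+ (kap.-1 * M0) != 0 by rewrite expf_neq0 // fy expf_neq0.
rewrite rootE; apply/eqP/(mulfI fy0); rewrite mulr0.
transitivity ((\sum_t c t *: T t).[y]); last by rewrite cT horner0.
rewrite /Z !horner_sum mulr_sumr; apply: eq_bigr => -[[j l] k] _.
have lj : (j <= kap.-1)%N by have := ltn_ord j; lia.
have frob_sub : y - v0 ^+ nu = (b - v0) ^+ nu.
  by have := rmorphB (frob (r * i) pK) b v0; rewrite /= /frob expnM => ->.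
have aE : a = f.[b] ^+ M0 * f.[y] ^+ M0.
  by rewrite -fb fy exprS exprAC.
rewrite !hornerZ /T /U /= !hornerE /= frob_sub (_ : y ^+ nu = b); last by rewrite /y -exprM.
have -> : f.[y] ^+ (kap.-1 * M0) = f.[y] ^+ (M0 * j) * f.[y] ^+ ((kap.-1 - j) * M0).
  by rewrite -exprD (mulnC M0) -mulnDl subnKC.
rewrite aE exprMn -!exprM (mulnC j M0) exprD.
ring.
Qed.

Hypothesis kap_dvd : (kap %| q.-1)%N.

Lemma dvdn_pred_expq i : (kap %| (q ^ i).-1)%N.
Proof.
by apply: dvdn_trans kap_dvd _; rewrite -!subn1 -{2}(exp1n i) subn_exp dvdn_mulr.
Qed.

(** [stepanov_step] with [A] and [B] close to [q ^ i / kap]: no value is taken much more often than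
    its expected share. *)
Lemma stepanov : exists C i1 : nat, forall i a, (i1 <= i)%N -> a != 0 ->
  (kap * count (fun b => f.[b] ^+ ((q ^ i.*2).-1 %/ kap) == a) (fixpts K p r i.*2)
    <= q ^ i.*2 + C * q ^ i)%N.
Proof.
exists (kap * (5 * delta + 9))%N, (kap * (2 * mu + 8)).+1 => i a i1 a0.
have ltq : (i < q ^ i)%N by rewrite ltn_expl // (pexp_gt1 pK).
have qE := divnK (dvdn_pred_expq i).
set M0 := (_ %/ _)%N in qE.
have nuE : (q ^ i)%N = (kap * M0).+1 by rewrite mulnC qE prednK // (leq_trans _ ltq).
have -> : ((q ^ i.*2).-1 %/ kap = M0 * (q ^ i).+1)%N.
  rewrite -addnn expnD.
  have -> : ((q ^ i * q ^ i).-1 = kap * (M0 * (q ^ i).+1))%N by rewrite nuE; nia.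
  by rewrite mulKn.
have M0b : (2 * mu + 8 <= M0)%N.
  have : (kap * (2 * mu + 8) < (kap * M0).+1)%N by rewrite -nuE (leq_trans _ ltq) // leqW.
  by rewrite ltnS leq_pmul2l.
(* [A = M0 - mu] keeps the orders distinct. The excess of [B] over [M0] makes the family outnumber
   the dimension, while [kap * B * q ^ i] stays within [q ^ (2 i) + O(q ^ i)]. *)
have := @stepanov_step i M0 (M0 - mu) (M0 + (4 * delta + 8)) a _ nuE _ _ a0.
set ct := count _ _; rewrite -addnn expnD => /(_ (leq_trans _ i1) _ _) st.
have {st} : (ct <= delta * q ^ i + (M0 - mu) + (M0 + (4 * delta + 8)) * q ^ i)%N.
  apply: st => //.
    by rewrite subnK ?nuE ?leqnSn //; lia.
  rewrite nuE; have [A M0A] : exists A, M0 = (A + mu)%N.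
    by exists (M0 - mu)%N; rewrite subnK //; lia.
  rewrite M0A addnK; have A8 : (mu + 8 <= A)%N by lia.
  have h1 : (delta * (kap * (A + mu)) <= 2 * (delta * kap * A))%N.
    have : (delta * kap * mu <= delta * kap * A)%N by rewrite leq_mul2l; apply/orP; right; lia.
    lia.
  have h2 : (delta * 8 <= delta * kap * A)%N.
    by rewrite -mulnA leq_mul2l; apply/orP; right; apply: leq_trans (leq_pmull _ kap_gt0); lia.
  have h3 : (A <= kap * A)%N by rewrite leq_pmull.
  have -> : (kap * (A + mu + (4 * delta + 8)) * A =
     kap * (A + mu) * A + 4 * (delta * kap * A) + 8 * (kap * A))%N by ring.
  have -> : (A * (kap * (A + mu)).+1 = kap * (A + mu) * A + A)%N by rewrite mulnS; ring.
  rewrite mulnS; lia.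
move=> h; have : (kap * ct <= kap * (delta * q ^ i + q ^ i + (M0 + (4 * delta + 8)) * q ^ i))%N.
  rewrite leq_mul2l; apply/orP; right; apply: leq_trans h _; rewrite !leq_add2r leq_add2l nuE.
  nia.
move/leq_trans; apply; move: nuE; set nu := (q ^ i)%N => nuE.
have : (kap * M0 <= nu)%N by rewrite nuE.
nia.
Qed.

End Stepanov.

(** * Weil's bound for multiplicative character sums *)

Section Weil.
Variables (K : closedFieldType) (p r : nat) (pK : p \in [pchar K]).
Hypothesis r_gt0 : (0 < r)%N.
Let q := (p ^ r)%N.
Variables (kap : nat).
Hypothesis kap_gt0 : (0 < kap)%N.
Hypothesis kap_dvd : (kap %| q.-1)%N.

Variables (C : archiClosedFieldType) (us : seq K) (chi : K -> C).
Hypothesis us_uniq : uniq us.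
Hypothesis mem_us : forall a, (a \in us) = (a ^+ kap == 1).
Hypothesis size_us : size us = kap.
Hypothesis chi0 : chi 0 = 0.
Hypothesis chi1 : chi 1 = 1.
Hypothesis chi_norm : forall a, a \in us -> `|chi a| = 1.
Hypothesis chiM_us : forall a b, a \in us -> b \in us -> chi (a * b) = chi a * chi b.
Hypothesis chi_sum : \sum_(a <- us) chi a = 0.

Variables (f : {poly K}) (v0 : K).
Hypothesis f_neq0 : f != 0.
Hypothesis f_fixed : fixedp r pK f.
Hypothesis mu_coprime : coprime (mup v0 f) kap.

Let M := (q.-1 %/ kap)%N.
Let fix_ := fixpts K p r.

Let q_gt1 : (1 < q)%N := pexp_gt1 pK r_gt0.

Lemma char_dom_M a b : ((a == 0) || (a \in us)) -> ((b == 0) || (b \in us)) ->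
  chi (a * b) = chi a * chi b.
Proof.
by case: eqP => [->|_]; rewrite ?mul0r ?chi0 ?mul0r //; case: eqP => [->|_];
   rewrite ?mulr0 ?chi0 ?mulr0 //; exact: chiM_us.
Qed.

Lemma fixed_expM_dom j x : x ^+ (q ^ j) = x ->
  (x ^+ ((q ^ j).-1 %/ kap) == 0) || (x ^+ ((q ^ j).-1 %/ kap) \in us).
Proof.
move=> xq; have [->|x0] := eqVneq x 0.
  case: (_ %/ _)%N => [|e]; last by rewrite expr0n eqxx.
  by rewrite expr0 mem_us expr1n eqxx orbT.
rewrite mem_us -exprM divnK ?(dvdn_pred_expq kap_dvd) //; apply/orP; right.
apply/eqP/(mulfI x0); rewrite mulr1 -exprS prednK // expn_gt0.
by rewrite ltnW.
Qed.

(** The exponent composes the norm down to the field with [q] elements, of exponent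
    [(q ^ j - 1) / (q - 1)], with the power [M] that lands in [us] or at 0. *)
Definition char_sum j := \sum_(b <- fix_ j) chi (f.[b] ^+ ((q ^ j).-1 %/ kap)).

Lemma fixpts_horner j b : (0 < j)%N -> b \in fix_ j -> f.[b] ^+ (q ^ j) = f.[b].
Proof.
by move=> j0; rewrite mem_fixpts // => /eqP bj; rewrite -(fixedp_horner _ _ f_fixed) bj.
Qed.

Lemma divn_exp_gt0 j : (0 < j)%N -> (0 < (q ^ j).-1 %/ kap)%N.
Proof.
move=> j0; rewrite divn_gt0 // dvdn_leq ?(dvdn_pred_expq kap_dvd) //.
by have := expq_gt1 pK r_gt0 j0; rewrite -/q; case: (q ^ j)%N => [|[]].
Qed.

Lemma count_zeros j : (0 < j)%N -> (count (fun b => f.[b] == 0%R) (fix_ j) <= (size f).-1)%N.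
Proof.
move=> j0; rewrite -size_filter -ltnS prednK ?size_poly_gt0 //.
apply: max_poly_roots => //; last by rewrite filter_uniq // uniq_fixpts.
by apply/allP => b; rewrite mem_filter => /andP[].
Qed.

(** Stepanov bounds each count from above only; as the counts add up to [q ^ (2 i)] less the few
    zeros of [f], none can be much too small either. *)
Lemma char_sum_even_bound : exists C0 i0 : nat, forall i, (i0 <= i)%N ->
  `|char_sum i.*2| <= C0%:R * q%:R ^+ i.
Proof.
have [C0 [i1 st]] := stepanov r_gt0 kap_gt0 f_neq0 f_fixed mu_coprime kap_dvd.
exists (2 * C0 + (size f).-1)%N, i1.+1 => i i1i.
have i2 : (0 < i.*2)%N by rewrite double_gt0 (leq_trans _ i1i).
pose w b := f.[b] ^+ ((q ^ i.*2).-1 %/ kap).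
pose N a := count (fun b => w b == a) (fix_ i.*2).
pose n0 := count (fun b => f.[b] == 0) (fix_ i.*2).
have wdom b : b \in fix_ i.*2 -> (w b == 0) || (w b \in us).
  by move=> bf; apply: fixed_expM_dom; exact: fixpts_horner.
have us0 : 0 \notin us by rewrite mem_us expr0n gtn_eqF // eq_sym oner_eq0.
have Ntot : (\sum_(a <- us) N a + n0 = q ^ i.*2)%N.
  rewrite -(size_fixpts pK r_gt0 i2) -sum1_size /n0 -sum1_count.
  have -> : (\sum_(a <- us) N a = \sum_(b <- fix_ i.*2) (w b \in us))%N.
    rewrite /N; under eq_bigr => a _ do rewrite -sum1_count big_mkcond.
    rewrite exchange_big /=; apply: eq_bigr => b _.
    rewrite -big_mkcond sum1_count -(count_uniq_mem _ us_uniq); apply: eq_count => a /=.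
    by rewrite eq_sym.
  rewrite [X in (_ + X)%N]big_mkcond -big_split /=; apply: eq_big_seq => b bf.
  have w0 : (w b == 0) = (f.[b] == 0) by rewrite expf_eq0 divn_exp_gt0.
  have := wdom b bf; rewrite -w0; case: eqP => [->|_]; first by rewrite (negPf us0).
  by move=> /= ->.
have SE : char_sum i.*2 = \sum_(a <- us) chi a * (N a)%:R.
  transitivity (\sum_(b <- fix_ i.*2) \sum_(a <- us) (if w b == a then chi a else 0)).
    apply: eq_big_seq => b bf; rewrite -/(w b).
    have [w0|w0] := eqVneq (w b) 0.
      rewrite w0 chi0 big_seq big1 // => a au; case: eqP => // a0.
      by move: us0; rewrite a0 au.
    have wu : w b \in us by move: (wdom b bf); rewrite (negPf w0).
    rewrite (bigD1_seq (w b)) //= eqxx big1 ?addr0 // => a.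
    by rewrite eq_sym => /negPf->.
  rewrite exchange_big /=; apply: eq_bigr => a _.
  by rewrite -big_mkcond big_const_seq iter_addr addr0 mulr_natr.
(* As [chi] sums to zero, the expected value may be subtracted from every count. *)
have kS : kap%:R * char_sum i.*2 = \sum_(a <- us) chi a * ((kap * N a)%:R - (q ^ i.*2)%:R).
  rewrite SE mulr_sumr; under [RHS]eq_bigr => a _ do rewrite mulrBr.
  rewrite sumrB -mulr_suml chi_sum mul0r subr0; apply: eq_bigr => a _.
  by rewrite natrM mulrCA.
have D0 : 0 <= (C0 * q ^ i)%:R :> C by rewrite ler0n.
(* From [0 <= D] and [y <= D] follows [|y| <= D + (D - y)], whose sum over [a] is known from the
   total count. *)
have bd a : a \in us -> `|(kap * N a)%:R - (q ^ i.*2)%:R : C| <=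
   (2 * (C0 * q ^ i))%:R - ((kap * N a)%:R - (q ^ i.*2)%:R).
  move=> au; have a0 : a != 0 by apply: contraNneq us0 => <-.
  have := st i a (ltnW i1i) a0; rewrite -(ler_nat C) natrD -/q => h.
  set y := _ - _; have yD : y <= (C0 * q ^ i)%:R by rewrite lerBlDl.
  have {1}-> : y = (C0 * q ^ i)%:R - ((C0 * q ^ i)%:R - y) by rewrite subKr.
  apply: le_trans (ler_normB _ _) _.
  rewrite !ger0_norm ?subr_ge0 // mul2n -addnn natrD.
  by rewrite addrA.
rewrite -(ler_pM2l (_ : 0 < kap%:R)) ?ltr0n //.
have -> : kap%:R * `|char_sum i.*2| = `|kap%:R * char_sum i.*2| by rewrite normrM normr_nat.
rewrite kS; apply: le_trans (ler_norm_sum _ _ _) _.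
apply: le_trans (_ : \sum_(a <- us) ((2 * (C0 * q ^ i))%:R - ((kap * N a)%:R - (q ^ i.*2)%:R)) <= _).
  rewrite !big_seq; apply: ler_sum => a au.
  by rewrite normrM chi_norm // mul1r bd.
have -> : \sum_(a <- us) ((2 * (C0 * q ^ i))%:R - ((kap * N a)%:R - (q ^ i.*2)%:R)) =
   (kap * (2 * (C0 * q ^ i)) + kap * n0)%:R :> C.
  rewrite sumrB sumrB !big_const_seq !iter_addr !addr0 !count_predT size_us.
  have -> : \sum_(a <- us) (kap * N a)%:R = (kap * \sum_(a <- us) N a)%:R :> C.
    by rewrite big_distrr /= natr_sum.
  rewrite -Ntot -[X in X - _]mulr_natr -[X in _ - (_ - X)]mulr_natr !(natrM, natrD); ring.
rewrite -natrX -!natrM ler_nat -mulnDr leq_mul2l; apply/orP; right.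
rewrite mulnDl mulnA leq_add2l.
apply: leq_trans (count_zeros i2) _; rewrite leq_pmulr // expn_gt0.
by rewrite ltnW.
Qed.

(** * The character modulo the radical of [f] and its L-polynomial *)

Variable ws : seq K.
Hypothesis f_roots : f = lead_coef f *: \prod_(w <- ws) ('X - w%:P).

(* For [h] monic of degree [n], [c ^+ n * root_val h] is the product of the values
   of [f] at the roots of [h]; it depends only on [n] and on [h] modulo [g]. *)
Let c := (-1) ^+ size ws * lead_coef f.
Let g := \prod_(w <- undup ws) ('X - w%:P).
Let d := size (undup ws).

Definition root_val (h : {poly K}) := \prod_(w <- ws) h.[w].
Definition poly_char (h : {poly K}) := chi ((c ^+ (size h).-1 * root_val h) ^+ M).

Lemma lead_f_neq0 : lead_coef f != 0. Proof. by rewrite lead_coef_eq0. Qed.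

Lemma perm_ws : perm_eq (map (frob r pK) ws) ws.
Proof.
apply: (@fixedp_prod_perm _ _ _ pK (lead_coef f)); first exact: lead_f_neq0.
by rewrite -f_roots.
Qed.

Lemma twist_fixed : c ^+ q = c.
Proof.
rewrite /c exprMn -exprM mulnC exprM.
have -> : (-1) ^+ q = -1 :> K.
  have := rmorphN1 (frob r pK); rewrite /= /frob; exact.
by congr (_ * _); apply: (fixedpP r pK f f_fixed).
Qed.

Lemma twist_neq0 : c != 0.
Proof. by rewrite mulf_neq0 ?lead_f_neq0 // expf_neq0 // oppr_eq0 oner_eq0. Qed.

Lemma root_val_fixed h : fixedp r pK h -> root_val h ^+ q = root_val h.
Proof.
move=> fh; rewrite /root_val -prodrXl -[RHS](perm_big _ perm_ws) /= big_map.
apply: eq_bigr => w _; have := @fixedp_horner K p r pK 1 h w fh.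
by rewrite expn1 => ->.
Qed.

Lemma root_valM h1 h2 : root_val (h1 * h2) = root_val h1 * root_val h2.
Proof. by rewrite /root_val -big_split; apply: eq_bigr => w _; rewrite hornerM. Qed.

Lemma expM_dom x : x ^+ q = x -> (x ^+ M == 0) || (x ^+ M \in us).
Proof. by move=> xq; have := @fixed_expM_dom 1 x; rewrite expn1; apply. Qed.

Lemma poly_charM h1 h2 : fixedp r pK h1 -> fixedp r pK h2 -> h1 \is monic -> h2 \is monic ->
  poly_char (h1 * h2) = poly_char h1 * poly_char h2.
Proof.
move=> f1 f2 m1 m2; rewrite /poly_char -char_dom_M; last 2 first.
- by apply: expM_dom; rewrite exprMn root_val_fixed // -exprM mulnC exprM twist_fixed.
- by apply: expM_dom; rewrite exprMn root_val_fixed // -exprM mulnC exprM twist_fixed.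
rewrite -exprMn root_valM size_monicM ?monic_neq0 //; congr (chi (_ ^+ _)).
have -> : (size h1 + size h2).-1.-1 = ((size h1).-1 + (size h2).-1)%N.
  have : (0 < size h1)%N by rewrite size_poly_gt0 monic_neq0.
  have : (0 < size h2)%N by rewrite size_poly_gt0 monic_neq0.
  lia.
by rewrite exprD mulrACA.
Qed.

Lemma f_horner y : f.[y] = c * \prod_(w <- ws) (w - y).
Proof.
rewrite {1}f_roots hornerZ horner_prod /c [in RHS]mulrAC mulrC; congr (_ * _).
elim: (ws) => [|w s IHs]; first by rewrite !big_nil mulr1.
by rewrite !big_cons IHs hornerXsubC exprS /=; ring.
Qed.

(** For [b] in the field with [q ^ j] elements, both sides are the norm of [f.[b]]. *)
Lemma root_val_orbpoly j b :
  c ^+ j * root_val (orbpoly p r j b) = f.[b] ^+ (\sum_(i < j) q ^ i)%N.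
Proof.
have fb i : f.[b] ^+ (q ^ i) = c * \prod_(w <- ws) (w - b ^+ (q ^ i)).
  by rewrite -(fixedp_horner _ _ f_fixed) f_horner.
rewrite -prodrXr; under [RHS]eq_bigr => i _ do rewrite fb.
rewrite big_split /= prodr_const card_ord exchange_big; congr (_ * _).
apply: eq_bigr => w _; rewrite horner_prod; apply: eq_bigr => i _.
by rewrite hornerXsubC.
Qed.

Lemma exp_sumM j : ((\sum_(i < j) q ^ i) * M = (q ^ j).-1 %/ kap)%N.
Proof. by rewrite predn_exp [in RHS]mulnC muln_divA. Qed.

Lemma poly_char_orbpoly j b :
  poly_char (orbpoly p r j b) = chi (f.[b] ^+ ((q ^ j).-1 %/ kap)).
Proof.
by rewrite /poly_char (size_orbpoly p r) root_val_orbpoly -exprM exp_sumM.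
Qed.

Lemma point_sumE j : point_sum p r poly_char j = char_sum j.
Proof. by apply: eq_bigr => b _; rewrite poly_char_orbpoly. Qed.

Lemma poly_char1 : poly_char 1 = 1.
Proof.
rewrite /poly_char size_poly1 expr0 mul1r /root_val big1 ?expr1n ?chi1 // => w _.
by rewrite hornerC.
Qed.

(* Otherwise the character sums over large extensions would be close to their
   trivial bound, against [char_sum_even_bound]. *)
Lemma exists_nontrivial_value : exists u, fixedp r pK u /\
  chi (root_val u ^+ M) != 0 /\ chi (root_val u ^+ M) != 1.
Proof.
have [C0 [i0 bd]] := char_sum_even_bound.
pose dl := (size f).-1.
(* Large enough for [q ^ i > C0 + dl], and a multiple of [kap] so that the factor [c ^+ i.*2]
   becomes 1 after raising to the power [M]. *)
pose i := (kap * (i0 + C0 + dl).+1)%N.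
have i0i : (i0 + C0 + dl < i)%N by rewrite leq_pmull.
have i2 : (0 < i.*2)%N by rewrite double_gt0 (leq_ltn_trans _ i0i).
have [b bf [b0 b1]] : exists2 b, b \in fix_ i.*2 &
    f.[b] != 0 /\ chi (f.[b] ^+ ((q ^ i.*2).-1 %/ kap)) != 1.
  pose P b := (f.[b] != 0) && (chi (f.[b] ^+ ((q ^ i.*2).-1 %/ kap)) != 1).
  have [/hasP[b bf /andP[b0 b1]]|/hasPn nP] := boolP (has P (fix_ i.*2)); first by exists b.
  have e1 : char_sum i.*2 = (count (fun b => f.[b] != 0) (fix_ i.*2))%:R.
    rewrite -sum1_count natr_sum [RHS]big_mkcond; apply: eq_big_seq => b bf.
    have := nP b bf; rewrite /P; case: eqVneq => [fb0|_] /=.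
      by rewrite fb0 expr0n gtn_eqF ?divn_exp_gt0.
    by rewrite negbK => /eqP.
  have := bd i; rewrite e1 normr_nat -natrX -natrM ler_nat => h.
  have ii0 : (i0 <= i)%N by rewrite (leq_trans _ (ltnW i0i)) // -addnA leq_addr.
  have h3 := count_predC (fun b => f.[b] == 0) (fix_ i.*2).
  have eQ : (q ^ i.*2 = q ^ i * q ^ i)%N by rewrite -addnn expnD.
  rewrite (size_fixpts pK r_gt0 i2) -/q eQ in h3.
  have h1 := count_zeros i2; have h2 := h ii0; rewrite -/dl in h1.
  have iQ : (i < q ^ i)%N by rewrite ltn_expl // q_gt1.
  set Q := (q ^ i)%N in h3 h2 iQ; exfalso.
  (* With only trivial values, the sum is the number of nonzeros of [f], at least [Q * Q - dl], yet
     at most [C0 * Q]. *)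
  have : (Q * Q <= (dl + C0) * Q)%N.
    rewrite -h3 mulnDl leq_add //; apply: leq_trans h1 _.
    by rewrite leq_pmulr // (leq_ltn_trans _ iQ).
  by rewrite leq_mul2r; lia.
exists (orbpoly p r i.*2 b); have bi : b ^+ (q ^ i.*2) = b by apply/eqP; rewrite -mem_fixpts.
split; first exact: fixedp_orbpoly.
have -> : root_val (orbpoly p r i.*2 b) ^+ M = f.[b] ^+ ((q ^ i.*2).-1 %/ kap).
  rewrite -exp_sumM [RHS]exprM -root_val_orbpoly exprMn -exprM.
  have -> : (i.*2 * M = q.-1 * (i0 + C0 + dl).+1.*2)%N.
    by rewrite /i -[q.-1 in RHS](divnK kap_dvd) -!mul2n -/M; ring.
  rewrite exprM (_ : c ^+ q.-1 = 1) ?expr1n ?mul1r //.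
  by apply: (mulfI twist_neq0); rewrite -exprS prednK ?twist_fixed ?mulr1 // ltnW.
split=> //; have := fixed_expM_dom (fixpts_horner i2 bf).
rewrite expf_eq0 (negPf b0) andbF /= => bu.
by rewrite -normr_eq0 chi_norm // oner_eq0.
Qed.

Lemma radical_monic : g \is monic. Proof. exact: monic_prod_XsubC. Qed.

Lemma size_radical : size g = d.+1. Proof. exact: size_prod_XsubC. Qed.

Lemma radical_fixed : fixedp r pK g.
Proof. apply: fixedp_prod; apply: perm_phi_undup; exact: perm_ws. Qed.

Lemma fixed_divp h : fixedp r pK h -> fixedp r pK (h %/ g).
Proof. by rewrite /fixedp map_divp => /eqP->; rewrite (eqP radical_fixed). Qed.

Lemma fixed_modp h : fixedp r pK h -> fixedp r pK (h %% g).
Proof. by rewrite /fixedp map_modp => /eqP->; rewrite (eqP radical_fixed). Qed.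

Lemma root_radical w : w \in ws -> g.[w] = 0.
Proof. by move=> ww; apply/rootP; rewrite root_prod_XsubC mem_undup. Qed.

Lemma root_val_mod h : root_val (h %% g) = root_val h.
Proof.
rewrite /root_val big_seq [RHS]big_seq; apply: eq_bigr => w ww.
by rewrite [in RHS](divp_eq h g) hornerD hornerM root_radical // mulr0 add0r.
Qed.

(** Multiplication by some [u] prime to [g] permutes the residues modulo [g] and multiplies the sum
    by the value at [u], which is not 1. *)
Lemma low_sum0 : \sum_(h <- lows K p r d) chi (root_val h ^+ M) = 0.
Proof.
have [u [fu [u0 u1]]] := exists_nontrivial_value.
have ru w : w \in ws -> u.[w] != 0.
  move=> ww; apply: contraNneq u0 => uw; rewrite /root_val (big_rem w) //= uw mul0r.
  have := divn_exp_gt0 (ltn0Sn 0); rewrite expn1 -/M => M0.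
  by rewrite expr0n gtn_eqF // chi0.
pose m h := (u * h) %% g.
have mlow h : h \in lows K p r d -> m h \in lows K p r d.
  rewrite !(mem_lows pK r_gt0) => /andP[fh _]; rewrite fixed_modp ?fixedpM //=.
  by rewrite -ltnS -size_radical ltn_modp monic_neq0 // radical_monic.
have inj : {in lows K p r d &, injective m}.
  move=> h1 h2; rewrite !(mem_lows pK r_gt0) => /andP[_ s1] /andP[_ s2] /eqP.
  rewrite -subr_eq0 -modpN -modpD -mulrBr => dv.
  have : g %| h1 - h2.
    apply: uniq_roots_dvdp; last by rewrite uniq_rootsE undup_uniq.
    apply/allP => w; rewrite mem_undup => ww.
    have /dvdpP[k e] : g %| u * (h1 - h2) by rewrite /dvdp.
    have := congr1 (fun s => s.[w]) e; rewrite !hornerM root_radical // mulr0 => /eqP.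
    by rewrite mulf_eq0 (negPf (ru w ww)).
  have [|/dvdp_leq le /le] := eqVneq (h1 - h2) 0; first by move/eqP; rewrite subr_eq0 => /eqP.
  rewrite size_radical ltnNge.
  by rewrite (leq_trans (size_polyD _ _)) // size_polyN geq_max s1.
have pm : perm_eq [seq m h | h <- lows K p r d] (lows K p r d).
  have um : uniq [seq m h | h <- lows K p r d].
    by rewrite map_inj_in_uniq ?(uniq_polyext pK r_gt0).
  apply: uniq_perm; rewrite ?(uniq_polyext pK r_gt0) //.
  apply: (uniq_min_size um _ _).2; last by rewrite size_map.
  by move=> _ /mapP[h hl ->]; exact: mlow.
have E : \sum_(h <- lows K p r d) chi (root_val h ^+ M) =
   chi (root_val u ^+ M) * \sum_(h <- lows K p r d) chi (root_val h ^+ M).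
  rewrite -{1}(perm_big _ pm) big_map mulr_sumr; apply: eq_big_seq => h.
  rewrite (mem_lows pK r_gt0) => /andP[fh _].
  rewrite root_val_mod root_valM exprMn char_dom_M //.
    by apply: expM_dom; exact: root_val_fixed.
  by apply: expM_dom; exact: root_val_fixed.
move/eqP: E; rewrite eq_sym -subr_eq0 -{2}[\sum_(_ <- _) _]mul1r -mulrBl mulf_eq0.
by rewrite subr_eq0 (negPf u1) => /eqP.
Qed.

(** Division by [g] pairs every monic quotient with all residues, and for fixed [n] the character
    sees only the residue. So the L-series is a polynomial of degree less than [d]. *)
Lemma monic_sum_eq0 n : (d <= n)%N -> monic_sum p r poly_char n = 0.
Proof.
move=> dn; pose m (x : {poly K} * {poly K}) := x.1 * g + x.2.
have sg2 h : (size h <= d)%N -> (size h < size g)%N by rewrite size_radical ltnS.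
pose s := [seq m x | x <- allpairs pair (monics K p r (n - d)) (lows K p r d)].
have pm : perm_eq (monics K p r n) s.
  apply: uniq_perm; first exact: (uniq_polyext pK r_gt0).
    rewrite map_inj_in_uniq.
      by rewrite allpairs_uniq ?(uniq_polyext pK r_gt0) // => -[? ?] [? ?].
    move=> _ _ /allpairsP[[Q1 R1] /= [_ r1 ->]] /allpairsP[[Q2 R2] /= [_ r2 ->]].
    rewrite /m /= => e; move: r1 r2; rewrite !(mem_lows pK r_gt0).
    move=> /andP[_ /sg2 s1] /andP[_ /sg2 s2].
    have g0 : g != 0 by rewrite monic_neq0 ?radical_monic.
    have := congr1 (fun h => h %/ g) e; rewrite !divp_addl_mul // !divp_small // !addr0 => ->.
    by have := congr1 (fun h => h %% g) e; rewrite !modp_addl_mul_small // => ->.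
  move=> h; rewrite (mem_monics pK r_gt0); apply/idP/mapP.
    move=> /and3P[fh mh /eqP sh].
    exists (h %/ g, h %% g); last by rewrite /m /= -divp_eq.
    have sq : size (h %/ g) = (n - d).+1.
      by rewrite size_divp ?monic_neq0 ?radical_monic // sh size_radical /= subSn.
    apply: allpairs_f.
      rewrite (mem_monics pK r_gt0) fixed_divp // sq eqxx andbT /=.
      move: mh; rewrite {1}(divp_eq h g) !monicE lead_coefDl.
        by rewrite lead_coefM (monicP radical_monic) mulr1.
      rewrite size_Mmonic ?radical_monic -?size_poly_eq0 ?sq // size_radical addnS /=.
      have : (size (h %% g)%R < size g)%N by rewrite ltn_modp monic_neq0 ?radical_monic.
      by rewrite size_radical => /leq_trans; apply; rewrite addSn ltnS leq_addl.
    rewrite (mem_lows pK r_gt0) fixed_modp //= -ltnS -size_radical.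
    by rewrite ltn_modp monic_neq0 ?radical_monic.
  move=> [_ /allpairsP[[Q R] /= [Qm Rl ->]] ->]; rewrite /m /=.
  move: Qm Rl; rewrite (mem_monics pK r_gt0) (mem_lows pK r_gt0).
  move=> /and3P[fQ mQ /eqP sQ] /andP[fR sR].
  have sQg : size (Q * g) = n.+1.
    rewrite size_monicM ?monic_neq0 ?radical_monic // sQ size_radical addSn /= addnS.
    by rewrite subnK.
  have lt : (size R < size (Q * g)%R)%N by rewrite sQg ltnS (leq_trans sR).
  rewrite fixedpD ?fixedpM ?radical_fixed //= monicE lead_coefDl // size_polyDl // sQg eqxx andbT.
  by rewrite -monicE monicMl ?radical_monic.
rewrite /monic_sum (perm_big _ pm) /= big_map big_allpairs_dep /=.
rewrite big_seq big1 // => Q; rewrite (mem_monics pK r_gt0) => /and3P[fQ mQ /eqP sQ].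
transitivity (chi ((c ^+ n) ^+ M) * \sum_(R <- lows K p r d) chi (root_val R ^+ M)); last first.
  by rewrite low_sum0 mulr0.
rewrite mulr_sumr; apply: eq_big_seq => R.
rewrite (mem_lows pK r_gt0) => /andP[fR sR].
have sQg : size (Q * g) = n.+1.
  rewrite size_monicM ?monic_neq0 ?radical_monic // sQ size_radical addSn /= addnS.
  by rewrite subnK.
have lt : (size R < size (Q * g)%R)%N by rewrite sQg ltnS (leq_trans sR).
rewrite /poly_char /m /= size_polyDl // sQg /= -char_dom_M; last 2 first.
- by apply: expM_dom; rewrite -exprM mulnC exprM twist_fixed.
- by apply: expM_dom; exact: root_val_fixed.
rewrite -exprMn; congr (chi ((_ * _) ^+ _)).
by rewrite -root_val_mod modp_addl_mul_small // sg2.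
Qed.

Lemma weil_bound :
  `|\sum_(b <- fix_ 1) chi (f.[b] ^+ M)| <= d.-1%:R * sqrtC q%:R.
Proof.
have [C0 [i0 bd]] := char_sum_even_bound.
have -> : \sum_(b <- fix_ 1) chi (f.[b] ^+ M) = char_sum 1 by rewrite /char_sum expn1.
apply: (@newton_sharp_bound _ (monic_sum p r poly_char) char_sum d i0 _ C0%:R).
- by rewrite ltr0n ltnW.
- by rewrite /monic_sum /= big_seq1 poly_char1.
- exact: monic_sum_eq0.
- move=> n; rewrite (monic_sum_newton r_gt0 poly_charM).
  by apply: eq_bigr => i _; rewrite point_sumE.
- exact: bd.
Qed.

End Weil.

(** * Existence of a power value *)

Section RootCharacters.
Variables (K : fieldType) (C : numClosedFieldType) (kap : nat) (zeta : K) (omega : C).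
Hypothesis zeta_prim : kap.-primitive_root zeta.
Hypothesis omega_prim : kap.-primitive_root omega.

Definition mu_pts : seq K := [seq zeta ^+ i | i <- iota 0 kap].

(** The index in [mu_pts] is the discrete logarithm to base [zeta]: this is the [t]-th power of the
    isomorphism sending [zeta] to [omega], extended by zero. *)
Definition root_char (t : nat) (a : K) : C :=
  if a \in mu_pts then (omega ^+ index a mu_pts) ^+ t else 0.

Let kap_gt0 : (0 < kap)%N := prim_order_gt0 zeta_prim.

Lemma mem_mu_pts a : (a \in mu_pts) = (a ^+ kap == 1).
Proof.
apply/mapP/eqP => [[i _ ->]|/(prim_rootP zeta_prim)[i ->]].
  by rewrite -exprM mulnC exprM (prim_expr_order zeta_prim) expr1n.
by exists (val i); rewrite // mem_iota ltn_ord.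
Qed.

Lemma uniq_mu_pts : uniq mu_pts.
Proof.
rewrite map_inj_in_uniq ?iota_uniq // => i j; rewrite !mem_iota /= !add0n => ik jk /eqP.
by rewrite (eq_prim_root_expr zeta_prim) !modn_small // => /eqP.
Qed.

Lemma size_mu_pts : size mu_pts = kap.
Proof. by rewrite size_map size_iota. Qed.

Lemma root_char_expr t i : root_char t (zeta ^+ i) = omega ^+ (i * t).
Proof.
have mi : zeta ^+ i \in mu_pts.
  by rewrite mem_mu_pts -exprM mulnC exprM (prim_expr_order zeta_prim) expr1n.
rewrite /root_char mi exprM; congr (_ ^+ _).
apply/eqP; rewrite (eq_prim_root_expr omega_prim) -(eq_prim_root_expr zeta_prim).
have := nth_index 0 mi; rewrite (nth_map 0%N) ?nth_iota ?add0n; last 2 first.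
- by rewrite -size_mu_pts index_mem.
- by rewrite size_iota -size_mu_pts index_mem.
by move->.
Qed.

Lemma mu_ptsP a : a \in mu_pts -> exists i, a = zeta ^+ i.
Proof. by case/mapP => i _ ->; exists i. Qed.

Lemma root_char0 t : root_char t 0 = 0.
Proof. by rewrite /root_char mem_mu_pts expr0n gtn_eqF // eq_sym oner_eq0. Qed.

Lemma root_char1 t : root_char t 1 = 1.
Proof. by rewrite -(expr0 zeta) root_char_expr expr0. Qed.

Lemma root_charM t : {in mu_pts &, {morph root_char t : a b / a * b}}.
Proof.
move=> a b /mu_ptsP[i ->] /mu_ptsP[j ->].
by rewrite -exprD !root_char_expr -exprD mulnDl.
Qed.

Lemma root_char_norm t : {in mu_pts, forall a, `|root_char t a| = 1}.
Proof.
move=> _ /mu_ptsP[i ->]; rewrite root_char_expr normrX.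
have -> : `|omega| = 1.
  apply/eqP; have := pexprn_eq1 kap (normr_ge0 omega).
  by rewrite -normrX (prim_expr_order omega_prim) normr1 eqxx gtn_eqF.
by rewrite expr1n.
Qed.

Lemma sum_expr_root1 (z : C) : z != 1 -> z ^+ kap = 1 -> \sum_(i < kap) z ^+ i = 0.
Proof.
move=> z1 zk; have := subrX1 z kap; rewrite zk subrr => /esym/eqP.
by rewrite mulf_eq0 subr_eq0 (negPf z1) => /eqP.
Qed.

Lemma root_char_sum t : (0 < t < kap)%N -> \sum_(a <- mu_pts) root_char t a = 0.
Proof.
move=> /andP[t0 tk]; rewrite big_map -[kap]subn0 -/(index_iota 0 kap) big_mkord.
under eq_bigr => i _ do rewrite root_char_expr mulnC exprM.
apply: sum_expr_root1.
  rewrite -(prim_order_dvd omega_prim).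
  by apply/negP => /(dvdn_leq t0); rewrite leqNgt tk.
by rewrite -exprM mulnC exprM (prim_expr_order omega_prim) expr1n.
Qed.

Lemma root_char_orthogonal a :
  \sum_(t < kap) root_char t a = if a == 1 then kap%:R else 0.
Proof.
case: (boolP (a \in mu_pts)) => [|an].
  move=> au; have [i ai] := mu_ptsP au; rewrite ai.
  under eq_bigr => t _ do rewrite root_char_expr exprM.
  case: eqP => [/eqP|] zi1.
    rewrite -(prim_order_dvd zeta_prim) (prim_order_dvd omega_prim) in zi1.
    under eq_bigr => t _ do rewrite (eqP zi1) expr1n.
    by rewrite sumr_const card_ord.
  apply: sum_expr_root1.
    by rewrite -(prim_order_dvd omega_prim) (prim_order_dvd zeta_prim); apply/eqP.
  by rewrite -exprM mulnC exprM (prim_expr_order omega_prim) expr1n.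
have -> : (a == 1) = false.
  by apply: contraNF an => /eqP->; rewrite mem_mu_pts expr1n.
by rewrite big1 // => t _; rewrite /root_char (negPf an).
Qed.

End RootCharacters.

Section Existence.
Variables (K : closedFieldType) (p r : nat) (pK : p \in [pchar K]).
Hypothesis r_gt0 : (0 < r)%N.
Let q := (p ^ r)%N.
Variables (kap : nat).
Hypothesis kap_gt0 : (0 < kap)%N.
Hypothesis kap_dvd : (kap %| q.-1)%N.
Variables (C : archiClosedFieldType) (zeta : K) (omega : C).
Hypothesis zeta_prim : kap.-primitive_root zeta.
Hypothesis omega_prim : kap.-primitive_root omega.
Variables (f : {poly K}) (v0 : K) (ws : seq K).
Hypothesis f_neq0 : f != 0.
Hypothesis f_fixed : fixedp r pK f.
Hypothesis mu_coprime : coprime (mup v0 f) kap.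
Hypothesis f_roots : f = lead_coef f *: \prod_(w <- ws) ('X - w%:P).
Let d := size (undup ws).

(** Without such a [b], orthogonality makes the sums [S t] add up to zero; but [S 0] is at least
    [q - d], and Weil's bound keeps the others too small to balance it. *)
Lemma exists_power_value :
  (0 < d)%N -> ((d * kap.+1) ^ 2 <= q)%N ->
  exists2 b, b ^+ q = b & f.[b] ^+ (q.-1 %/ kap) = 1.
Proof.
move=> d0 dq; set M := (_ %/ _)%N.
have q1 : (1 < q)%N := pexp_gt1 pK r_gt0.
have [/hasP[b bf /eqP b1]|/hasPn none] := boolP (has (fun b => f.[b] ^+ M == 1) (fixpts K p r 1)).
  exists b => //; apply/eqP; move: bf; rewrite mem_fixpts // expn1; exact.
pose S t := \sum_(b <- fixpts K p r 1) root_char kap zeta omega t (f.[b] ^+ M).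
have S_sum : \sum_(t < kap) S t = 0.
  rewrite exchange_big big_seq big1 //= => b /none b1.
  by rewrite (root_char_orthogonal zeta_prim omega_prim) (negPf b1).
have S0 : (q - d)%:R <= S 0%N.
  have -> : S 0%N = (count (fun b => f.[b] != 0) (fixpts K p r 1))%:R.
    rewrite -sum1_count natr_sum [RHS]big_mkcond; apply: eq_big_seq => b bf.
    case: (eqVneq f.[b] 0) => fb0 /=.
      rewrite fb0 expr0n gtn_eqF ?(root_char0 _ zeta_prim) //.
      by rewrite divn_gt0 // dvdn_leq // -subn1 subn_gt0.
    rewrite /root_char expr0 ifT // (mem_mu_pts zeta_prim) -exprM divnK //.
    apply/eqP/(mulfI fb0); rewrite mulr1 -exprS prednK ?(ltnW q1) //.
    by have := fixpts_horner r_gt0 f_fixed (ltn0Sn 0) bf; rewrite expn1.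
  rewrite ler_nat leq_subLR.
  have := count_predC (fun b => f.[b] == 0) (fixpts K p r 1).
  rewrite (size_fixpts pK r_gt0) // expn1 -/q => <-; rewrite leq_add2r.
  rewrite -size_filter; apply: uniq_leq_size; first by rewrite filter_uniq ?(uniq_fixpts pK).
  move=> b; rewrite mem_filter mem_undup => /andP[fb _].
  move: fb; rewrite f_roots hornerZ mulf_eq0 lead_coef_eq0 (negPf f_neq0) /=.
  by rewrite -rootE root_prod_XsubC.
have St t : (0 < t < kap)%N -> `|S t| <= d.-1%:R * sqrtC q%:R.
  move=> tk; apply: (weil_bound r_gt0 kap_gt0 kap_dvd (uniq_mu_pts zeta_prim)
    (mem_mu_pts zeta_prim) (size_mu_pts kap zeta) _ _ _ _ _ f_neq0 f_fixed mu_coprime f_roots).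
  - exact: root_char0.
  - exact: root_char1.
  - exact: root_char_norm.
  - exact: root_charM.
  - exact: root_char_sum.
have S0_le : (q - d)%:R <= (kap.-1 * d.-1)%:R * sqrtC q%:R :> C.
  apply: (le_trans S0); rewrite -[leLHS]ger0_norm; last by rewrite (le_trans _ S0) ?ler0n.
  move: S_sum; rewrite -(big_mkord predT S) big_ltn // big_add1 big_mkord => /eqP.
  rewrite addr_eq0 => /eqP ->.
  rewrite normrN; apply: le_trans (ler_norm_sum _ _ _) _.
  apply: (@le_trans _ _ (\sum_(i < kap.-1) d.-1%:R * sqrtC q%:R)).
    by apply: ler_sum => i _; apply: St; have := ltn_ord i; lia.
  by rewrite big_const_ord iter_addr addr0 natrM -mulrA (mulr_natl _ kap.-1).
have S0_sq : ((q - d) ^ 2 <= (kap.-1 * d.-1) ^ 2 * q)%N.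
  rewrite -(ler_nat C) natrM (natrX _ (q - d) 2) (natrX _ (kap.-1 * d.-1) 2) -[q%:R in leRHS]sqrtCK -exprMn.
  by rewrite ler_pXn2r ?nnegrE ?mulr_ge0 ?ler0n ?sqrtC_ge0.
(* As [(q - d) ^ 2 >= q * (q - 2 * d)], a factor [q] cancels. *)
have {}S0_sq : (q - 2 * d <= (kap.-1 * d.-1) ^ 2)%N.
  rewrite -(leq_pmul2r (ltnW q1)); apply: leq_trans S0_sq.
  have [dq'|/ltnW] := leqP (2 * d) q; last by rewrite -subn_eq0 => /eqP->.
  have [e qE] : exists e, q = (2 * d + e)%N by exists (q - 2 * d)%N; rewrite subnKC.
  rewrite qE addKn (_ : 2 * d + e - d = d + e)%N; [nia | lia].
(* For [e = (kap - 1) * (d - 1)] this yields [(e + 2 * d) ^ 2 <= q <= e ^ 2 + 2 * d], absurd for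
   [d > 0]. *)
have eD : (kap.-1 * d.-1 + 2 * d <= d * kap.+1)%N.
  by case: (d) d0 => // d' _; case: (kap) kap_gt0 => // k' _ /=; nia.
move: dq eD S0_sq; set D := (d * kap.+1)%N; set e := (kap.-1 * d.-1)%N => dq eD qe.
have : ((e + 2 * d) ^ 2 <= e ^ 2 + 2 * d)%N.
  by apply: (@leq_trans (D ^ 2)); [rewrite leq_sqr | lia].
have : (0 < d * d)%N by rewrite muln_gt0 d0.
have : (d <= d * d)%N by rewrite leq_pmulr.
by rewrite sqrnD; lia.
Qed.

End Existence.

Lemma mup_exp (F : fieldType) (v : F) (h : {poly F}) n :
  h != 0 -> mup v (h ^+ n) = (n * mup v h)%N.
Proof.
move=> h0; elim: n => [|n IHn].
  by rewrite expr0 mupNroot // root1.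
by rewrite exprS mupM ?expf_neq0 // IHn mulSn.
Qed.

Lemma mup_simple_root (F : fieldType) (v : F) (h : {poly F}) :
  root h v -> ~~ root h^`() v -> mup v h = 1%N.
Proof.
move=> rh rh'; have h0 : h != 0.
  by apply: contraNneq rh' => ->; rewrite deriv0 root0.
apply/eqP; rewrite eqn_leq mup_leq // mup_geq // expr1 dvdp_XsubCl rh andbT.
apply: contra rh' => /dvdpP[g ->].
by rewrite expr2 mulrA derivM derivXsubC mulr1 rootE hornerD !hornerM hornerXsubC subrr !mulr0 addr0.
Qed.

(** * Linearized polynomials *)

Section Linearized.
Variables (K : closedFieldType) (p e s : nat) (c : nat -> K).
Hypothesis pK : p \in [pchar K].
Hypothesis e_gt0 : (0 < e)%N.
Hypothesis s_gt0 : (0 < s)%N.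
Hypothesis c0 : c 0%N != 0.
Hypothesis cs : c s != 0.
Let q0 := (p ^ e)%N.

Definition linpoly (t : nat) (a : nat -> K) : {poly K} :=
  \sum_(i < t.+1) a i *: 'X^(q0 ^ i).

Let H := linpoly s c.

Lemma size_linpoly : (size H <= (q0 ^ s).+1)%N.
Proof.
apply: leq_trans (size_sum _ _ _) _; apply/bigmax_leqP => i _.
apply: leq_trans (size_scale_leq _ _) _; rewrite size_polyXn ltnS.
by rewrite leq_exp2l ?(pexp_gt1 pK) // -ltnS.
Qed.

Lemma deriv_linpoly : H^`() = (c 0%N)%:P.
Proof.
rewrite /H /linpoly raddf_sum big_ord_recl /= expn0 derivZ derivX alg_polyC.
rewrite big1 ?addr0 // => i _; rewrite derivZ derivXn -mulr_natr -polyC_natr.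
by rewrite (natr_expq pK) // polyC0 mulr0 scaler0.
Qed.

Lemma root0_linpoly : root H 0.
Proof.
rewrite rootE horner_sum big1 // => i _; rewrite !hornerE expr0n gtn_eqF ?mulr0 //.
exact: (expq_gt0 pK).
Qed.

(** The derivative is the nonzero constant [c 0], so all roots are simple, and the degree exceeds 1.
    The root must avoid 0, where the factor ['X^(kap.-1)] will change the multiplicity. *)
Lemma linpoly_nonzero_root : exists2 v, v != 0 & mup v H = 1%N.
Proof.
have /factor_theorem[H1 HE] := root0_linpoly; rewrite subr0 in HE.
have sz : (size H1 != 1)%N.
  apply/eqP => sH1.
  have := congr1 (fun u : {poly K} => u`_(q0 ^ s)) HE.
  rewrite coefMX gtn_eqF ?(expq_gt0 pK) // [in RHS]nth_default; last first.
    by rewrite sH1; have := expq_gt1 pK e_gt0 s_gt0; rewrite -/q0; case: (q0 ^ s)%N => [|[]].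
  rewrite coef_sum big_ord_recr /= coefZ coefXn eqxx mulr1 big1 ?add0r.
    by move/eqP; rewrite (negPf cs).
  move=> i _; rewrite coefZ coefXn gtn_eqF ?mulr0 // ltn_exp2l ?(pexp_gt1 pK) //.
have /closed_rootP[v rv] := sz.
have H1'0 : H1.[0] = c 0%N.
  have := congr1 (fun u => u^`().[0]) HE.
  by rewrite deriv_linpoly derivM derivX mulr1 hornerC hornerD hornerMX mulr0 add0r => <-.
exists v.
  by apply: contraNneq c0 => v0; rewrite -H1'0; move: rv; rewrite v0 => /rootP->.
apply: mup_simple_root; first by rewrite HE rootM rv.
by rewrite deriv_linpoly rootC.
Qed.

(** The power [q0 ^ m] is additive and shifts the indices of a linearized polynomial by [m]. *)
Lemma linpoly_frob m (a : nat -> K) :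
  (forall i, (i < m)%N -> a i = 0) -> (forall i, (i <= s)%N -> c i ^+ (q0 ^ m) = a (m + i)%N) ->
  linpoly (m + s) a = H ^+ (q0 ^ m).
Proof.
move=> am ca; have pP : p \in [pchar {poly K}] by rewrite pchar_poly.
have -> : H ^+ (q0 ^ m) = frob (e * m) pP H by rewrite /frob expnM.
rewrite rmorph_sum /= /linpoly -addnS big_split_ord /= big1 ?add0r; last first.
  by move=> i _; rewrite am // scale0r.
apply: eq_bigr => i _; rewrite /frob expnM -/q0 exprZn ca; last by rewrite -ltnS.
by rewrite -exprM -expnD addnC.
Qed.

End Linearized.

(** * Power residues in a finite field *)

Lemma finfield_power_residue (F : finFieldType) (kap : nat) (z : F) :
  (kap %| #|F|.-1)%N -> z ^+ (#|F|.-1 %/ kap) = 1 -> exists x, z = x ^+ kap.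
Proof.
move=> kd zM; have F1 : (0 < #|F|.-1)%N by rewrite -subn1 subn_gt0 finNzRing_gt1.
have kap0 : (0 < kap)%N by case: (kap) kd => //; rewrite dvd0n; case: (#|F|.-1) F1.
have M0 : (0 < #|F|.-1 %/ kap)%N by rewrite divn_gt0 // dvdn_leq.
have unity (x : F) : x != 0 -> x ^+ #|F|.-1 = 1.
  move=> x0; apply: (mulfI x0); rewrite mulr1 -exprS prednK ?expf_card //.
  by rewrite ltnW // finNzRing_gt1.
have /hasP[g _ gp] : has #|F|.-1.-primitive_root [seq x <- enum F | x != 0].
  apply: has_prim_root => //; last 1 first.
  - rewrite size_filter cardE -(count_predC (pred1 0) (enum F)).
    by rewrite count_uniq_mem ?enum_uniq // mem_enum.
  - by apply/allP => x; rewrite mem_filter => /andP[x0 _]; apply/unity_rootP/unity.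
  - by rewrite filter_uniq // enum_uniq.
have z1 : z ^+ #|F|.-1 = 1 by rewrite -(divnK kd) exprM zM expr1n.
have [i zi] := prim_rootP gp z1.
have : (kap %| i)%N.
  move/eqP: zM; rewrite zi -exprM -(prim_order_dvd gp) -{1}(divnK kd) mulnC.
  by rewrite dvdn_pmul2r.
by case/dvdnP => j ij; exists (g ^+ j); rewrite zi ij exprM.
Qed.

(** Bezout's identity in the exponent, modulo [#|F|.-1]; it allows [q ^ k - 1] to be replaced by a
    divisor of [#|F|.-1]. *)
Lemma finfield_gcd_power (F : finFieldType) (a : nat) (x : F) :
  (0 < a)%N -> x != 0 -> exists2 y, y != 0 & x ^+ gcdn a #|F|.-1 = y ^+ a.
Proof.
move=> a0 x0; have [u v e _] := egcdnP #|F|.-1 a0.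
exists (x ^+ u); first by rewrite expf_neq0.
rewrite -exprM e exprD mulnC exprM.
have -> : x ^+ #|F|.-1 = 1.
  apply: (mulfI x0); rewrite mulr1 -exprS prednK ?expf_card //.
  by rewrite ltnW // finNzRing_gt1.
by rewrite expr1n mul1r.
Qed.

Lemma linearized_power_value (F : finFieldType) (q n k m s : nat) (alpha : F)
    (b : nat -> F) :
  prime_power q -> #|F| = (q ^ n)%N -> (0 < k)%N -> (0 < s)%N ->
  (2 * (k + s) <= n)%N -> alpha != 0 ->
  (forall i, (i < m)%N -> b i = 0) -> b m != 0 -> b (m + s)%N != 0 ->
  exists u x, [/\ u != 0, x != 0 &
    \sum_(i < (m + s).+1) b i * u ^+ (q ^ i) = alpha * x ^+ (q ^ k).-1 * u].
Proof.
move=> [p [e [p_prime [e_gt0 qE]]]] cardF k_gt0 s_gt0 ksn alpha0 bm0 bm bs.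
have n_gt0 : (0 < n)%N by lia.
have N0E : #|F| = (p ^ (e * n))%N by rewrite cardF qE expnM.
have r_gt0 : (0 < e * n)%N by rewrite muln_gt0 e_gt0.
have pF : p \in [pchar F] by exact: card_finPcharP N0E p_prime.
have q1 : (1 < q)%N by rewrite qE -[X in (X < _)%N](exp1n e) ltn_exp2r // prime_gt1.
have qk2 : (1 < q ^ k)%N by rewrite -[X in (X < _)%N](expn0 q) ltn_exp2l.
have qk1 : (0 < (q ^ k).-1)%N by rewrite -subn1 subn_gt0.
have F1 : (0 < #|F|.-1)%N by rewrite -subn1 subn_gt0 finNzRing_gt1.
pose kap := gcdn (q ^ k).-1 #|F|.-1.
have kap_gt0 : (0 < kap)%N by rewrite gcdn_gt0 qk1.
have kap_dvd : (kap %| #|F|.-1)%N by exact: dvdn_gcdr.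
have kap_le : (kap < q ^ k)%N.
  by apply: leq_ltn_trans (dvdn_leq qk1 (dvdn_gcdl _ _)) _; rewrite ltn_predL ltnW.
have [K [iota _]] := countable_algebraic_closure F.
have pK : p \in [pchar K] by exact: rmorph_pchar iota _ pF.
have iota_fixed z : iota z ^+ (p ^ (e * n)) = iota z by rewrite -N0E -rmorphXn expf_card.
have coprime_kap j : coprime (q ^ j) kap.
  apply: coprimeXl; apply: (coprime_dvdr kap_dvd); apply: (@coprime_dvdl _ #|F|).
    by rewrite cardF dvdn_exp.
  by rewrite coprime_sym -[X in coprime _ X](prednK (ltnW (finNzRing_gt1 F))) coprimenS.
have [zeta zetaP] : exists zeta : K, kap.-primitive_root zeta.
  have kapK : kap%:R != 0 :> K.
    rewrite -(dvdn_pcharf pK); apply/negP => pkap.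
    have := coprime_kap 1%N; rewrite expn1 => /(coprime_dvdr pkap).
    by move/(coprime_dvdl (_ : p %| q)%N); rewrite qE dvdn_exp // prime_coprime // dvdnn => /(_ isT).
  have [rs rsE] := closed_field_poly_normal ('X^kap - 1 : {poly K}).
  rewrite lead_coefXnsubC // scale1r in rsE.
  have /hasP[z _ zP] : has kap.-primitive_root rs; last by exists z.
  apply: has_prim_root => //.
  - by apply/allP => z zrs; rewrite /root_of_unity rsE root_prod_XsubC.
  - by rewrite -separable_prod_XsubC -rsE separable_Xn_sub_1.
  - by rewrite -ltnS -(size_prod_XsubC rs id) -rsE size_XnsubC.
have [omega omegaP] := C_prim_root_exists kap_gt0.
have iter_card (z : F) j : z ^+ (q ^ (n * j)) = z.
  elim: j => [|j IHj]; first by rewrite muln0 expn0 expr1.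
  by rewrite mulnS expnD exprM -cardF expf_card.
(* The [q ^ m]-th roots of the coefficients: the power [q ^ (n * m)] is the identity on [F]. *)
pose c i := iota (b (m + i)%N ^+ (q ^ (n * m - m))).
have cb i : c i ^+ (q ^ m) = iota (b (m + i)%N).
  by rewrite -rmorphXn -exprM -expnD subnK ?iter_card // leq_pmull.
have c0 : c 0%N != 0 by rewrite fmorph_eq0 expf_neq0 // addn0.
have cs : c s != 0 by rewrite fmorph_eq0 expf_neq0.
pose H := linpoly p e s c.
have GH : linpoly p e (m + s) (iota \o b) = H ^+ (q ^ m).
  rewrite qE; apply: linpoly_frob => //.
    by move=> i im /=; rewrite bm0 ?rmorph0.
  by move=> i _; rewrite -qE cb.
have H0 : H != 0.
  apply: contra c0 => /eqP Hz; have := @deriv_linpoly K p e s c pK e_gt0.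
  by rewrite -/H Hz deriv0 => /esym/eqP; rewrite polyC_eq0.
(* A value [x0 ^+ kap] of [f] at [u != 0] means [G = alpha * (x0 / u) ^+ kap * u], with [G] the sum
   in the conclusion. *)
pose f := iota alpha^-1 *: ('X^(kap.-1) * H ^+ (q ^ m)).
have f0 : f != 0.
  by rewrite scaler_eq0 fmorph_eq0 invr_eq0 (negPf alpha0) mulf_neq0 // expf_neq0 // ?polyX_eq0.
have f_fixed : fixedp (e * n) pK f.
  have -> : f = map_poly iota (alpha^-1 *: ('X^(kap.-1) *
      \sum_(i < (m + s).+1) b i *: 'X^(q ^ i))).
    rewrite /f -GH map_polyZ rmorphM /= map_polyXn rmorph_sum /linpoly -qE.
    congr (_ *: (_ * _)); apply: eq_bigr => i _.
    by rewrite /= map_polyZ map_polyXn.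
  by apply/fixedpP => i; rewrite coef_map /= iota_fixed.
have [v0 v00 mv0] := @linpoly_nonzero_root K p e s c pK e_gt0 s_gt0 c0 cs.
(* This multiplicity is [q ^ m], and [kap] divides [q ^ n - 1]. *)
have mv : coprime (mup v0 f) kap.
  rewrite /f -mul_polyC mupMr ?rootC ?fmorph_eq0 ?invr_eq0 //.
  rewrite mupMr; last by rewrite rootE hornerXn expf_neq0.
  by rewrite mup_exp // mv0 muln1.
have [ws fws] := closed_field_poly_normal f.
have mem_ws w : (w \in ws) = root f w.
  by rewrite [in RHS]fws rootZ ?lead_coef_eq0 // root_prod_XsubC.
have v0ws : v0 \in ws.
  rewrite mem_ws rootZ ?fmorph_eq0 ?invr_eq0 // rootM; apply/orP; right.
  rewrite rootE horner_exp expf_eq0 expn_gt0 (ltnW q1) -rootE.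
  by apply: contraT => /mupNroot; rewrite mv0.
(* Every root of [f] is a root of [H], including 0, so neither ['X^(kap.-1)] nor the power [q ^ m]
   adds a distinct root. *)
have d_le : (size (undup ws) <= q ^ s)%N.
  rewrite -ltnS; apply: leq_trans (_ : size H <= _)%N; last first.
    by rewrite qE; apply: size_linpoly.
  apply: max_poly_roots; rewrite ?undup_uniq //; apply/allP => w.
  rewrite mem_undup mem_ws rootZ ?fmorph_eq0 ?invr_eq0 // rootM => /orP[|].
    rewrite rootE hornerXn expf_eq0 => /andP[_ /eqP->].
    exact: (@root0_linpoly K p e s c pK e_gt0).
  by rewrite rootE horner_exp expf_eq0 => /andP[_].
have d_gt0 : (0 < size (undup ws))%N.
  by have : v0 \in undup ws; [rewrite mem_undup | case: (undup ws)].
have [] := @exists_power_value K p (e * n) pK r_gt0 kap kap_gt0 _ algC zeta omega zetaP omegaP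
   f v0 ws f0 f_fixed mv fws d_gt0.
- by rewrite -N0E.
- rewrite -N0E cardF; apply: leq_trans (_ : (q ^ s * q ^ k) ^ 2 <= _)%N.
    by rewrite leq_sqr leq_mul.
  by rewrite -expnD -expnM leq_exp2l // mulnC addnC.
move=> y; rewrite -N0E => yN fy1.
(* The image of [F] has as many elements as the fixed field, hence fills it. *)
have [u yu] : exists u, y = iota u.
  have us : uniq (map iota (enum F)).
    by rewrite map_inj_uniq ?enum_uniq //; exact: fmorph_inj.
  have sub : {subset map iota (enum F) <= fixpts K p (e * n) 1}.
    by move=> _ /mapP[z _ ->]; rewrite (mem_fixpts pK) // expn1 iota_fixed.
  have sz : (size (fixpts K p (e * n) 1) <= size (map iota (enum F)))%N.
    by rewrite (size_fixpts pK) // size_map -cardE expn1 N0E.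
  have /mapP[u _ ->] : y \in map iota (enum F).
    by rewrite (uniq_min_size us sub sz).2 (mem_fixpts pK) // expn1 -N0E yN.
  by exists u.
pose G := \sum_(i < (m + s).+1) b i * u ^+ (q ^ i).
pose z := alpha^-1 * (u ^+ kap.-1 * G).
have fz : f.[y] = iota z.
  rewrite yu /f -GH hornerZ hornerM hornerXn /linpoly horner_sum /z /G.
  rewrite !rmorphM rmorph_sum rmorphXn /=; congr (_ * (_ * _)).
  by apply: eq_bigr => i _; rewrite hornerZ hornerXn rmorphM rmorphXn /= -qE.
have zM : z ^+ (#|F|.-1 %/ kap) = 1.
  by apply: (fmorph_inj iota); rewrite rmorphXn rmorph1 /= -fz.
have M0 : (0 < #|F|.-1 %/ kap)%N by rewrite divn_gt0 // dvdn_leq.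
have z0 : z != 0.
  by apply/eqP => zz; move/eqP: zM; rewrite zz expr0n gtn_eqF // eq_sym oner_eq0.
have u0 : u != 0.
  apply: contraTneq z0 => uz; rewrite negbK /z /G big1 ?mulr0 // => i _.
  by rewrite uz expr0n gtn_eqF ?mulr0 // expn_gt0 ltnW.
have [x0 zx] := finfield_power_residue kap_dvd zM.
have x00 : x0 != 0.
  by apply: contraTneq z0 => xz; rewrite negbK zx xz expr0n gtn_eqF.
have xu0 : x0 / u != 0 by rewrite mulf_neq0 ?invr_eq0.
have [x x_neq0 ex] := finfield_gcd_power qk1 xu0.
exists u, x; split=> //; rewrite -ex -/kap -/G.
have -> : G = alpha * z / u ^+ kap.-1.
  by rewrite /z; field; rewrite alpha0 expf_neq0.
rewrite zx expr_div_n (_ : u ^+ kap = u * u ^+ kap.-1); last by rewrite -exprS prednK.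
by field; rewrite u0 expf_neq0.
Qed.

(** * The coefficients of [f] and the degree condition *)

Lemma mem_supp (F : fieldType) d (a : nat -> F) i :
  (i \in supp d a) = (i <= d)%N && (a i != 0).
Proof. by rewrite mem_filter mem_iota add0n ltnS andbC. Qed.

Lemma supp_sorted (F : fieldType) d (a : nat -> F) : sorted ltn (supp d a).
Proof. by apply: sorted_filter; [exact: ltn_trans | exact: iota_ltn_sorted]. Qed.

(** The [b i] are the coefficients of [f(y) - beta y^(q^h)] in terms of [u = y^(q^h)], and [m] is
    the first index of their support. The assumptions on [f] ensure that at least two of them are
    nonzero. *)
Lemma mh_first_coef (F : fieldType) (d h : nat) (beta : F) (a : nat -> F) :
  a d != 0 -> ~~ is_monomial d a -> (h <= ell d a)%N ->
  (is_binomial d a /\ h = ell d a -> a h != beta) ->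
  let m := mh d a beta h in
  let b i := a (h + i)%N - (if i == 0%N then beta else 0) in
  [/\ (forall i, (i < h)%N -> a i = 0), (forall i, (i < m)%N -> b i = 0),
      b m != 0, (h + m < d)%N & b (d - h)%N != 0].
Proof.
rewrite /is_monomial /is_binomial /mh /ell /ell2 => ad.
have : d \in supp d a by rewrite mem_supp leqnn.
have := supp_sorted d a; have := mem_supp d a.
case: (supp d a) => [//|x S] memS /= Ssort dS S1 hx binom.
have allS := order_path_min ltn_trans Ssort.
have axx : (x <= d)%N && (a x != 0) by rewrite -memS inE eqxx.
have small i : (i < x)%N -> a i = 0.
  move=> ix; apply/eqP; apply: contraTT ix => ai.
  have [id|di] := leqP i d; last by rewrite -leqNgt ltnW // (leq_ltn_trans _ di) //; case/andP: axx.
  have : i \in x :: S by rewrite memS id.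
  rewrite -leqNgt inE => /orP[/eqP->//|/(allP allS)]; exact: ltnW.
case: S memS Ssort dS S1 allS binom => [//|y S] memS /= /andP[xy Ssort] dS _ allS binom.
have ayy : (y <= d)%N && (a y != 0) by rewrite -memS !inE eqxx orbT.
have xd : (x < d)%N by rewrite (leq_trans xy) //; case/andP: ayy.
have hd : (h < d)%N by rewrite (leq_ltn_trans hx).
have bd : a (h + (d - h))%N - (if (d - h)%N == 0%N then beta else 0) != 0.
  by rewrite subnKC ?(ltnW hd) // subn_eq0 leqNgt hd subr0.
have sh i : (i < h)%N -> a i = 0 by move=> ih; apply: small; apply: leq_trans hx.
have [ahb|ahb] /= := eqVneq (a h) beta; last first.
  by split=> //; rewrite ?addn0 ?subr_eq0.
have [b0|b0] := eqVneq beta 0.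
  have hx' : (h < x)%N.
    rewrite ltn_neqAle hx andbT; apply: contraTneq axx => <-.
    by rewrite ahb b0 eqxx andbF.
  split=> //.
  - by move=> i ix; rewrite b0 if_same subr0 small // -ltn_subRL.
  - by rewrite b0 if_same subr0 subnKC //; case/andP: axx.
  - by rewrite subnKC.
have hxE : h = x.
  apply/eqP; rewrite eqn_leq hx leqNgt; apply/negP => /small ah0.
  by rewrite -ahb ah0 eqxx in b0.
(* Here [h] is the first exponent and its term is cancelled by [beta], so [f] is not a binomial and
   a third exponent exists. *)
have yd : (y < d)%N.
  case: S memS Ssort dS allS binom => [|w S] memS Ssort dS allS binom.
    by have := binom (conj erefl hxE); rewrite ahb eqxx.
  have : w \in [:: x, y, w & S] by rewrite !inE eqxx !orbT.
  by rewrite memS => /andP[wd _]; case/andP: Ssort => yw _; exact: leq_trans wd.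
have hy : (h < y)%N by rewrite hxE.
split=> //.
- move=> i iy; case: eqP => [->|/eqP i0]; first by rewrite addn0 ahb subrr.
  rewrite subr0; apply/eqP; apply: contraTT iy => ai; rewrite -leqNgt leq_subLR.
  have [id|di] := leqP (h + i) d; last by rewrite (leq_trans (ltnW yd)) // ltnW.
  have : (h + i)%N \in x :: y :: S by rewrite memS id.
  rewrite !inE -hxE -[X in _ == X]addn0 eqn_add2l (negPf i0) /= => /orP[/eqP->//|hiS].
  exact: ltnW (allP (order_path_min ltn_trans Ssort) _ hiS).
- rewrite subnKC ?(ltnW hy) // subn_eq0 leqNgt hy subr0; by case/andP: ayy.
- by rewrite subnKC // ltnW.
Qed.

(** The first entry of the maximum is [k + (d - h - m)], and either branch bounds it by [n / 2]. *)
Lemma degree_condition (n k d h m : nat) : (h + m <= d)%N ->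
  (let lhs : rat := Num.max ((k + d)%:R - h%:R - m%:R) ((d%:R - h%:R) / 2) in
   if (m%:R <= (d%:R - h%:R) / 2 :> rat) then lhs <= n%:R / 2
   else lhs <= n%:R / 2 - 1) ->
  (2 * (k + (d - h - m)) <= n)%N.
Proof.
move=> hmd /= H; have {}H : (k + d)%:R - h%:R - m%:R <= n%:R / 2 :> rat.
  by move: H; case: ifP => _; rewrite ge_max => /andP[? _]; lra.
have [s dE] : exists s, d = (h + m + s)%N by exists (d - (h + m))%N; rewrite subnKC.
rewrite -(ler_nat rat) natrM natrD -subnDA dE addKn.
by move: H; rewrite dE !natrD; lra.
Qed.

Theorem theorem3p11 (F : finFieldType) (q n k d h : nat)
    (alpha beta : F) (a : nat -> F) :
  prime_power q -> #|F| = (q ^ n)%N -> (2 <= n)%N ->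
  alpha != 0 -> (1 <= k)%N -> (k < n)%N ->
  (d < n)%N -> a d != 0 -> (forall i, (d < i)%N -> a i = 0) ->
  ~~ is_monomial d a ->
  (h <= ell d a)%N ->
  (is_binomial d a /\ h = ell d a -> a h != beta) ->
  (let m := mh d a beta h in
   let lhs : rat := Num.max ((k + d)%:R - h%:R - m%:R) ((d%:R - h%:R) / 2) in
   if (m%:R <= (d%:R - h%:R) / 2 :> rat) then lhs <= n%:R / 2
   else lhs <= n%:R / 2 - 1) ->
  exists x y : F, x != 0 /\ y != 0 /\
    same_point (x, gqpoly q k alpha beta x) (y ^+ (q ^ h)%N, fqpoly q d a y).
Proof.
move=> q_pp cardF n2 alpha0 k1 kn dn ad _ nmono hell binom deg.
have [ah bm0 bm hmd bD] := mh_first_coef ad nmono hell binom.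
move: deg; set m := mh d a beta h in bm0 bm hmd * => deg.
have {}deg := degree_condition (ltnW hmd) deg.
pose s := (d - h - m)%N; pose b i := a (h + i)%N - (if i == 0%N then beta else 0).
have s0 : (0 < s)%N by rewrite subn_gt0 ltn_subRL.
have ms : (m + s = d - h)%N by rewrite subnKC // leq_subRL; lia.
have [u [x [u0 x0 eq]]] : exists u x, [/\ u != 0, x != 0 &
    \sum_(i < (m + s).+1) b i * u ^+ (q ^ i) = alpha * x ^+ (q ^ k).-1 * u].
  by apply: (linearized_power_value (n := n)) => //; rewrite ms.
have q0 : (0 < q)%N by case: q_pp => p [e [pp [_ ->]]]; rewrite expn_gt0 prime_gt0.
(* The [q ^ h]-th root of [u], as the power [q ^ (n * h)] is the identity on [F]. *)
pose y := u ^+ (q ^ (n * h - h)).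
have yu : y ^+ (q ^ h) = u.
  rewrite -exprM -expnD subnK; last by rewrite leq_pmull // ltnW.
  elim: (h) => [|j IHj]; first by rewrite muln0 expn0 expr1.
  by rewrite mulnS expnD exprM -cardF expf_card.
have fy : fqpoly q d a y = alpha * x ^+ (q ^ k).-1 * u + beta * u.
  have dE : d.+1 = (h + (d - h).+1)%N by lia.
  rewrite -eq /fqpoly ms dE big_split_ord /= big1 ?add0r; last first.
    by move=> i _; rewrite ah ?mul0r.
  rewrite !big_ord_recl /= /b /= addn0 expn0 expr1 yu mulrBl.
  rewrite addrAC subrK; congr (_ + _); apply: eq_bigr => i _.
  by rewrite subr0 expnD exprM yu.
exists x, y; split=> //; split; first by rewrite expf_neq0.
(* The first coordinates [x] and [y ^+ (q ^ h) = u] force this scalar. *)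
exists (x / u); rewrite mulf_neq0 ?invr_eq0 //= yu divfK //; split=> //; split=> //.
rewrite fy /gqpoly.
have -> : x ^+ (q ^ k) = x * x ^+ (q ^ k).-1 by rewrite -exprS prednK // expn_gt0 q0.
by field.
Qed.
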